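(* There is an algorithm that, given a finite-state automaton $\mathcal{S}=(X,T,X_0,\to,\Sigma,\ell)$, a specification $X_{\mathrm{spec}}\subset X\times X$, and $k_1,k_2\in\mathbb{N}$, decides in polynomial time (polynomial in the size of $\mathcal{S}$ and in $k_1,k_2$) whether $\mathcal{S}$ is $\omega$-$(k_1,k_2)$-D-detectable with respect to $X_{\mathrm{spec}}$.
   Context: A finite-state automaton (FSA) is a sextuple $\mathcal{S}=(X,T,X_0,\to,\Sigma,\ell)$, where $X$ is a finite set of states, $T$ a finite set of events, $X_0\subset X$ a set of initial states, $\to\subset X\times T\times X$ a transition relation, $\Sigma$ a finite set of labels, and $\ell:T\to\Sigma\cup\{\epsilon\}$ a labeling function ($\epsilon$ is the empty word). No further assumption (deadlock-freeness, absence of unobservable cycles, etc.) is made. $\ell$ is extended to finite and infinite event sequences by $\ell(t_1t_2\dots)=\ell(t_1)\ell(t_2)\dots$, $\ell(\epsilon)=\epsilon$. For $s=t_1\cdots t_n\in T^*$, $x\xrightarrow{s}x'$ means that there are states $x=x_0,x_1,\dots,x_n=x'$ with $(x_{i-1},t_i,x_i)\in\to$ for all $i$ (so $x\xrightarrow{\epsilon}x$). The size of $\mathcal{S}$ is e.g. $|X|+|T|+|\Sigma|+|\to|$. For $\sigma_1,\sigma_2\in\Sigma^*$ define the delayed state estimate $$\mathcal{M}(\mathcal{S},\sigma_1,\sigma_2)=\{x\in X\mid \exists x_0\in X_0,\ \exists x'\in X,\ \exists s_1,s_2\in T^*:\ \ell(s_1)=\sigma_1,\ \ell(s_2)=\sigma_2,\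 x_0\xrightarrow{s_1}x\xrightarrow{s_2}x'\}.$$ The $\omega$-language $\mathcal{L}^\omega(\mathcal{S})$ is the set of $\sigma\in\Sigma^\omega$ (infinite words) such that $\sigma=\ell(t_1t_2\dots)$ for some infinite event sequence $t_1t_2\dots\in T^\omega$ for which there are states $x_0,x_1,\dots$ with $x_0\in X_0$ and $(x_i,t_{i+1},x_{i+1})\in\to$ for all $i\in\mathbb{N}$. Write $\sigma'\sqsubset\sigma$ if the finite word $\sigma'$ is a prefix of $\sigma$. $\mathcal{S}$ is $\omega$-$(k_1,k_2)$-D-detectable with respect to $X_{\mathrm{spec}}\subset X\times X$ if for all $\sigma\in\mathcal{L}^\omega(\mathcal{S})$ and all $\sigma_1,\sigma_2\in\Sigma^*$ with $\sigma_1\sigma_2\sqsubset\sigma$: if $|\sigma_1|\ge k_1$ and $|\sigma_2|\ge k_2$, then $(\mathcal{M}(\mathcal{S},\sigma_1,\sigma_2)\times\mathcal{M}(\mathcal{S},\sigma_1,\sigma_2))\cap X_{\mathrm{spec}}=\emptyset$. *)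

(* Defs.v *)
From HB Require Import structures.
From mathcomp Require Import all_boot all_algebra.

Set Implicit Arguments.
Unset Strict Implicit.
Unset Printing Implicit Defensive.

(** * Finite-state automata and delayed detectability *)

Record fsa := Fsa {
  state : finType;
  event : finType;
  init : {set state};
  trans : {set state * event * state};
  label : finType;
  labeling : event -> option label  (* None is the empty word *)
}.

Section Detectability.
Variable S : fsa.

Definition label_word (s : seq (event S)) : seq (label S) :=
  pmap (@labeling S) s.

Fixpoint run (x : state S) (s : seq (event S)) (x' : state S) : Prop :=
  if s is t :: s' then exists y, (x, t, y) \in trans S /\ run y s' x'
  else x = x'.

Definition delayed_estimate (sigma1 sigma2 : seq (label S)) (x : state S) :
    Prop :=
  exists x0 x' s1 s2,
    [/\ x0 \in init S, label_word s1 = sigma1, label_word s2 = sigma2,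
        run x0 s1 x & run x s2 x'].

Definition omega_prefix (w : seq (label S)) (sigma : nat -> label S) : Prop :=
  w = mkseq sigma (size w).

(* sigma is the infinite concatenation of the labels of t 0, t 1, ...; the
   second clause rules out the event sequences whose label is a finite word. *)
Definition omega_label (t : nat -> event S) (sigma : nat -> label S) : Prop :=
  (forall m, omega_prefix (label_word (mkseq t m)) sigma) /\
  (forall n, exists m, n <= size (label_word (mkseq t m))).

Definition omega_language (sigma : nat -> label S) : Prop :=
  exists (t : nat -> event S) (x : nat -> state S),
    [/\ x 0 \in init S, forall i, (x i, t i, x i.+1) \in trans S
      & omega_label t sigma].

Definition omega_D_detectable (k1 k2 : nat) (Xspec : {set state S * state S}) :
    Prop :=
  forall sigma, omega_language sigma ->
  forall sigma1 sigma2, omega_prefix (sigma1 ++ sigma2) sigma ->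
  k1 <= size sigma1 -> k2 <= size sigma2 ->
  ~ exists x y, [/\ delayed_estimate sigma1 sigma2 x,
                    delayed_estimate sigma1 sigma2 y & (x, y) \in Xspec].

Definition fsa_size : nat :=
  #|state S| + #|event S| + #|label S| + #|trans S|.

End Detectability.

(** * Model of computation

    Jones' WHILE language (N. D. Jones, Computability and Complexity from a
    Programming Perspective, 1997): imperative programs over binary trees.
    Every evaluated operator, assignment and test costs one time unit.  Trees
    are immutable and there is no tree equality test (only the test for a leaf),
    so with pointers to shared nodes each unit is a constant number of pointer
    operations and allocates at most one node.  Hence time in this model agrees
    with Turing machine time up to a polynomial, even though a tree written out
    without sharing may be exponentially larger than the time used. *)

Inductive tree := Leaf | Node of tree & tree.

Definition lchild (d : tree) : tree := if d is Node a _ then a else Leaf.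
Definition rchild (d : tree) : tree := if d is Node _ b then b else Leaf.

Inductive expr :=
  | EVar of nat
  | ELeaf
  | ENode of expr & expr
  | ELeft of expr
  | ERight of expr.

Inductive com :=
  | Skip
  | Assign of nat & expr
  | Seq of com & com
  | If of expr & com & com
  | While of expr & com.

Definition store := nat -> tree.

Fixpoint eval (s : store) (e : expr) : tree :=
  match e with
  | EVar x => s x
  | ELeaf => Leaf
  | ENode a b => Node (eval s a) (eval s b)
  | ELeft a => lchild (eval s a)
  | ERight a => rchild (eval s a)
  end.

Fixpoint eval_time (e : expr) : nat :=
  match e with
  | EVar _ | ELeaf => 1
  | ENode a b => (eval_time a + eval_time b).+1
  | ELeft a | ERight a => (eval_time a).+1
  end.

(* exec c s t s': from the store s, the program c halts in time exactly t with
   the store s'.  In tests, a leaf is false and every other tree is true. *)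
Inductive exec : com -> store -> nat -> store -> Prop :=
  | ExecSkip s : exec Skip s 1 s
  | ExecAssign s x e :
      exec (Assign x e) s (eval_time e).+1 [eta s with x |-> eval s e]
  | ExecSeq c1 c2 s1 s2 s3 t1 t2 :
      exec c1 s1 t1 s2 -> exec c2 s2 t2 s3 -> exec (Seq c1 c2) s1 (t1 + t2) s3
  | ExecIfTrue e c1 c2 s s' t :
      eval s e <> Leaf -> exec c1 s t s' ->
      exec (If e c1 c2) s (eval_time e + t).+1 s'
  | ExecIfFalse e c1 c2 s s' t :
      eval s e = Leaf -> exec c2 s t s' ->
      exec (If e c1 c2) s (eval_time e + t).+1 s'
  | ExecWhileTrue e c s1 s2 s3 t1 t2 :
      eval s1 e <> Leaf -> exec c s1 t1 s2 -> exec (While e c) s2 t2 s3 ->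
      exec (While e c) s1 (eval_time e + t1 + t2).+1 s3
  | ExecWhileFalse e c s :
      eval s e = Leaf -> exec (While e c) s (eval_time e).+1 s.

Lemma exec_det c s t1 s1 t2 s2 :
  exec c s t1 s1 -> exec c s t2 s2 -> t1 = t2 /\ s1 = s2.
Proof.
move=> H; elim: H t2 s2 => {c s t1 s1}.
- by move=> s t2 s2 H; inversion H.
- by move=> s x e t2 s2 H; inversion H.
- move=> c1 c2 s1 s2 s3 t1 t2 _ IH1 _ IH2 t' s' H.
  inversion H as [| |? ? ? ? ? ? ? E1 E2| | | |]; subst.
  by have [? ?] := IH1 _ _ E1; subst; have [-> ->] := IH2 _ _ E2.
- move=> e c1 c2 s s' t ne _ IH t' s1 H.
  by inversion H as [| | |? ? ? ? ? ? ? E| | |]; subst => //; have [-> ->] := IH _ _ E.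
- move=> e c1 c2 s s' t ee _ IH t' s1 H.
  by inversion H as [| | | |? ? ? ? ? ? ? E| |]; subst => //; have [-> ->] := IH _ _ E.
- move=> e c s1 s2 s3 t1 t2 ne _ IH1 _ IH2 t' s' H.
  inversion H as [| | | | |? ? ? ? ? ? ? ? E1 E2|]; subst => //.
  by have [? ?] := IH1 _ _ E1; subst; have [-> ->] := IH2 _ _ E2.
- by move=> e c s ee t' s' H; inversion H; subst.
Qed.

Definition input_store (d : tree) : store := fun x => if x is 0 then d else Leaf.

(* The input is in variable 0; the answer is yes iff variable 0 is not a leaf when
   the program halts. *)
Definition decides_within (c : com) (d : tree) (bound : nat) (P : Prop) : Prop :=
  exists t s, [/\ exec c (input_store d) t s, t <= bound & s 0 <> Leaf <-> P].

(** * Encoding of instances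

    Numbers are in unary.  This is harmless, since the running time is measured
    against the cardinalities of the components of the automaton and the values
    of k1 and k2, not the lengths of their binary notations. *)

Definition enc_nat (n : nat) : tree := iter n (Node Leaf) Leaf.

Definition enc_seq (A : Type) (enc : A -> tree) (s : seq A) : tree :=
  foldr (fun a => Node (enc a)) Leaf s.

Definition enc_opt (A : Type) (enc : A -> tree) (o : option A) : tree :=
  if o is Some a then Node (enc a) Leaf else Leaf.

Definition enc_elt (A : finType) (a : A) : tree := enc_nat (enum_rank a).

Definition enc_trans (S : fsa) (r : state S * event S * state S) : tree :=
  Node (enc_elt r.1.1) (Node (enc_elt r.1.2) (enc_elt r.2)).

Definition enc_fsa (S : fsa) : tree :=
  Node (enc_nat #|state S|)
 (Node (enc_nat #|event S|)
 (Node (enc_seq (@enc_elt _) (enum (init S)))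
 (Node (enc_seq (@enc_trans S) (enum (trans S)))
 (Node (enc_nat #|label S|)
       (enc_seq (fun t => enc_opt (@enc_elt _) (labeling t))
                (enum (event S))))))).

Definition enc_spec (S : fsa) (Xspec : {set state S * state S}) : tree :=
  enc_seq (fun r => Node (enc_elt r.1) (enc_elt r.2)) (enum Xspec).

Definition enc_input (S : fsa) (Xspec : {set state S * state S})
    (k1 k2 : nat) : tree :=
  Node (enc_fsa S) (Node (enc_spec Xspec) (Node (enc_nat k1) (enc_nat k2))).

(* Main.v *)
Require Import Defs.
From HB Require Import structures.
From mathcomp Require Import all_boot all_algebra zify.

Set Implicit Arguments.
Unset Strict Implicit.
Unset Printing Implicit Defensive.

(* Detectability fails iff three runs of the automaton read a common word
   sigma1 sigma2 with |sigma1| >= k1 and |sigma2| >= k2, two of them being in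
   the states of a specified pair after sigma1, while the first one can be
   prolonged to an infinite run with infinitely many labels.  By pigeonhole the
   last condition means that it can emit |X| more labels, since some state is
   then visited twice with a label in between.  So failure is the existence of a
   walk in the product of three copies of the automaton that crosses at least
   k1, k2 and |X| labelled edges in three consecutive phases, which is decided
   by iterating images of sets of triples of states.  Every such set is filtered
   from the list of all triples, so no intermediate value grows beyond a
   polynomial size and the functions involved are composed from loops of
   polynomial length. *)

(** * Polynomial bounds *)

Definition poly_fun (f : nat -> nat) : Prop :=
  exists p : {poly nat}, forall n, f n = horner p n.

Lemma poly_fun_const k : poly_fun (fun=> k).
Proof. by exists (k%:P)%R => n; rewrite hornerC. Qed.

Lemma poly_fun_id : poly_fun id.
Proof. by exists 'X%R => n; rewrite hornerX. Qed.

Lemma poly_fun_succ f : poly_fun f -> poly_fun (fun n => (f n).+1).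
Proof.
by move=> [p fE]; exists (p + 1%:P)%R => n; rewrite hornerD hornerC -fE; apply/esym/addn1.
Qed.

Lemma poly_fun_add f g : poly_fun f -> poly_fun g -> poly_fun (fun n => f n + g n).
Proof. by move=> [p fE] [q gE]; exists (p + q)%R => n; rewrite hornerD fE gE. Qed.

Lemma poly_fun_mul f g : poly_fun f -> poly_fun g -> poly_fun (fun n => f n * g n).
Proof. by move=> [p fE] [q gE]; exists (p * q)%R => n; rewrite hornerM fE gE. Qed.

Lemma poly_fun_comp f g : poly_fun f -> poly_fun g -> poly_fun (fun n => f (g n)).
Proof. by move=> [p fE] [q gE]; exists (p \Po q)%R => n; rewrite horner_comp fE gE. Qed.

(** The coefficients are natural numbers, so each Horner step [p * 'X + c] preserves
    monotonicity. *)
Lemma poly_fun_mono f : poly_fun f -> {homo f : m n / m <= n}.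
Proof.
move=> [p fE] m n le_mn; rewrite !fE; elim/poly_ind: p {f fE} => [|p c IH].
  by rewrite !horner0.
by rewrite !hornerD !hornerM !hornerC !hornerX leq_add // leq_mul.
Qed.

Ltac poly_fun_tac :=
  solve [repeat first [exact: poly_fun_id | exact: poly_fun_const | eassumption
    | apply: poly_fun_add | apply: poly_fun_mul | apply: poly_fun_comp]].

(** * Polynomial-time computability *)

Fixpoint tree_size (d : tree) : nat :=
  if d is Node a b then (tree_size a + tree_size b).+1 else 1.

(* [f] is computable from [e]: both are functions of an index, which ranges over
   the instances together with the values of the variables bound by the
   enclosing loops, and [e] encodes this context.  So ptime is a preorder, and
   the types of the encoded values may depend on the index.  The bound on the
   size of the output makes it transitive; the variables from [n] on are left
   alone so that programs can save their data there. *)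
Definition ptime (I : Type) (e f : I -> tree) : Prop :=
  exists c n T, poly_fun T /\ forall i s, s 0 = e i ->
    exists t s', [/\ exec c s t s', s' 0 = f i,
      forall x, n <= x -> s' x = s x, t <= T (tree_size (e i)) &
      tree_size (f i) <= T (tree_size (e i))].

Section Combinators.
Variable I : Type.
Implicit Types e f g : I -> tree.

Lemma ptime_size e f : ptime e f ->
  exists2 T, poly_fun T & forall i, tree_size (f i) <= T (tree_size (e i)).
Proof.
move=> [c [n [T [TP H]]]]; exists T => // i.
by have [t [s' []]] := H i (fun=> e i) erefl.
Qed.

Lemma ptime_ext e f g : f =1 g -> ptime e f -> ptime e g.
Proof.
move=> fg [c [n [T [TP H]]]]; exists c, n, T; split=> // i s /H.
by rewrite fg.
Qed.

Lemma ptime_refl e : ptime e e.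
Proof.
exists Skip, 0, S; split=> [|i s se]; first exact: poly_fun_succ poly_fun_id.
by exists 1, s; split=> //; exact: ExecSkip.
Qed.

Lemma ptime_trans e f g : ptime e f -> ptime f g -> ptime e g.
Proof.
move=> [c [n [T [TP H]]]] [c' [n' [T' [T'P H']]]].
exists (Seq c c'), (maxn n n'), (fun m => T m + T' (T m)); split.
  by poly_fun_tac.
move=> i s /H [t [s1 [E1 /H' [t' [s2 [E2 s2g fr2 t2 g2]]] fr1 t1 f1]]].
have le := poly_fun_mono T'P f1.
exists (t + t'), s2; split=> //.
- exact: ExecSeq E1 E2.
- by move=> x; rewrite geq_max => /andP[? ?]; rewrite fr2 // fr1.
- by rewrite leq_add // (leq_trans t2).
- by rewrite (leq_trans g2) // (leq_trans le) // leq_addl.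
Qed.

Lemma ptime_leaf e : ptime e (fun=> Leaf).
Proof.
exists (Assign 0 ELeaf), 1, (fun=> 2); split; first exact: poly_fun_const.
move=> i s _; exists 2, [eta s with 0 |-> Leaf]; split=> //.
  exact: (ExecAssign s 0 ELeaf).
by case.
Qed.

Lemma ptime_left e f : ptime e f -> ptime e (fun i => lchild (f i)).
Proof.
move/ptime_trans; apply.
exists (Assign 0 (ELeft (EVar 0))), 1, (fun m => 3 + m); split.
  by poly_fun_tac.
move=> i s si; exists 3, [eta s with 0 |-> lchild (f i)]; split=> //.
- by rewrite -si; exact: (ExecAssign s 0 (ELeft (EVar 0))).
- by case.
- by case: (f i) => //= a b; lia.
Qed.

Lemma ptime_right e f : ptime e f -> ptime e (fun i => rchild (f i)).
Proof.
move/ptime_trans; apply.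
exists (Assign 0 (ERight (EVar 0))), 1, (fun m => 3 + m); split.
  by poly_fun_tac.
move=> i s si; exists 3, [eta s with 0 |-> rchild (f i)]; split=> //.
- by rewrite -si; exact: (ExecAssign s 0 (ERight (EVar 0))).
- by case.
- by case: (f i) => //= a b; lia.
Qed.

(** The input is saved in a variable [m] beyond both frames and distinct from 0, so that the second
    program can start from it after the first has overwritten variable 0. *)
Lemma ptime_node e f g :
  ptime e f -> ptime e g -> ptime e (fun i => Node (f i) (g i)).
Proof.
move=> [c [n [T [TP H]]]] [c' [n' [T' [T'P H']]]].
pose m := (maxn n n').+1.
exists (Seq (Assign m (EVar 0)) (Seq c (Seq (Assign m.+1 (EVar 0))
  (Seq (Assign 0 (EVar m)) (Seq c' (Assign 0 (ENode (EVar m.+1) (EVar 0)))))))).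
exists m.+2, (fun k => T k + T' k + 10); split; first by poly_fun_tac.
move=> i s si.
set s1 := [eta s with m |-> s 0].
have [t [s2 [E2 s2f fr2 t2 f2]]] := H i s1 si.
set s3 := [eta s2 with m.+1 |-> s2 0].
set s4 := [eta s3 with 0 |-> s3 m].
have s40 : s4 0 = e i.
  by rewrite /s4 /s3 /= ltn_eqF // fr2 ?leqW ?leq_maxl //= eqxx.
have [t' [s5 [E5 s5g fr5 t5 g5]]] := H' i s4 s40.
exists (2 + (t + (2 + (2 + (t' + 4))))), [eta s5 with 0 |-> Node (s5 m.+1) (s5 0)].
split.
- apply: ExecSeq (ExecAssign _ _ _) _; apply: ExecSeq E2 _.
  apply: ExecSeq (ExecAssign _ _ _) _; apply: ExecSeq (ExecAssign _ _ _) _.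
  apply: ExecSeq E5 _; exact: (ExecAssign s5 0 (ENode (EVar m.+1) (EVar 0))).
- by rewrite fr5 ?s5g /= ?eqxx ?s2f // /m; lia.
- move=> x mx; have [xn xn'] : n <= x /\ n' <= x by move: mx; rewrite /m; lia.
  rewrite /= ifN ?fr5 //=; last by move: mx; lia.
  by rewrite !ifN ?fr2 //= ?ifN //; move: mx; lia.
- by rewrite /=; lia.
- by rewrite /=; lia.
Qed.

Definition is_node (d : tree) : bool := if d is Node _ _ then true else false.

Lemma ptime_if e f g1 g2 : ptime e f -> ptime e g1 -> ptime e g2 ->
  ptime e (fun i => if is_node (f i) then g1 i else g2 i).
Proof.
move=> [c [n [T [TP H]]]] [c1 [n1 [T1 [T1P H1]]]] [c2 [n2 [T2 [T2P H2]]]].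
pose m := (maxn n (maxn n1 n2)).+1.
exists (Seq (Assign m (EVar 0)) (Seq c (If (EVar 0)
  (Seq (Assign 0 (EVar m)) c1) (Seq (Assign 0 (EVar m)) c2)))).
exists m.+1, (fun k => T k + (T1 k + T2 k) + 10); split; first by poly_fun_tac.
move=> i s si.
set s1 := [eta s with m |-> s 0].
have [t [s2 [E2 s2f fr2 t2 f2]]] := H i s1 si.
set s3 := [eta s2 with 0 |-> s2 m].
have s30 : s3 0 = e i by rewrite /s3 /= fr2 ?[LHS]/= ?eqxx // /m; lia.
have fr3 x : m < x -> s3 x = s x.
  move=> mx; rewrite /s3 /= ifN; last by lia.
  by rewrite fr2 /= ?ifN //; move: mx; rewrite /m; lia.
case fE: (is_node (f i)).
  have [t' [s5 [E5 s5g fr5 t5 g5]]] := H1 i s3 s30.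
  exists (2 + (t + (1 + (2 + t')).+1)), s5; split=> //.
  - apply: ExecSeq (ExecAssign _ _ _) _; apply: ExecSeq E2 _.
    apply: (@ExecIfTrue (EVar 0)); first by rewrite /= s2f; case: (f i) fE.
    apply: ExecSeq (ExecAssign _ _ _) _; exact: E5.
  - by move=> x mx; rewrite fr5 ?fr3 //; move: mx; rewrite /m; lia.
  - by rewrite /=; lia.
  - by rewrite /=; lia.
have [t' [s5 [E5 s5g fr5 t5 g5]]] := H2 i s3 s30.
exists (2 + (t + (1 + (2 + t')).+1)), s5; split=> //.
- apply: ExecSeq (ExecAssign _ _ _) _; apply: ExecSeq E2 _.
  apply: (@ExecIfFalse (EVar 0)); first by rewrite /= s2f; case: (f i) fE.
  apply: ExecSeq (ExecAssign _ _ _) _; exact: E5.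
- by move=> x mx; rewrite fr5 ?fr3 //; move: mx; rewrite /m; lia.
- by rewrite /=; lia.
- by rewrite /=; lia.
Qed.

End Combinators.

Lemma ptime_reindex (I J : Type) (phi : J -> I) (e f : I -> tree) :
  ptime e f -> ptime (fun j => e (phi j)) (fun j => f (phi j)).
Proof. by move=> [c [n [T [TP H]]]]; exists c, n, T; split=> // j s /H. Qed.

(** What is computable from the context outside a loop remains so inside, where the bound value is
    put in front of that context. *)
Lemma ptime_weak (I J : Type) (phi : J -> I) (e f : I -> tree) (b : J -> tree) :
  ptime e f -> ptime (fun j => Node (b j) (e (phi j))) (fun j => f (phi j)).
Proof.
move/(ptime_reindex phi)/(ptime_trans _); apply.
exact: (ptime_right (ptime_refl (fun j => Node (b j) (e (phi j))))).
Qed.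

(** * Folds *)

Section Fold.
Variables (I : Type) (A B : I -> Type).
Variables (encA : forall i, A i -> tree) (encB : forall i, B i -> tree).
Variables (e : I -> tree) (l : forall i, seq (A i)) (b0 : forall i, B i).
Variable h : forall i, B i -> A i -> B i.

(** The types of elements and accumulators depend on the index, so the loop body is indexed by the
    outer index bundled with the current accumulator and element. *)
Definition fold_env (z : {i : I & (B i * A i)%type}) : tree :=
  Node (encB (projT2 z).1) (Node (encA (projT2 z).2) (e (projT1 z))).

Definition fold_step (z : {i : I & (B i * A i)%type}) : tree :=
  encB (h (projT2 z).1 (projT2 z).2).

(** Invariant: variable 0 holds the accumulator, [m] the rest of the list and [m.+1] the outer
    context; the last two survive the body because [n < m]. The bound [Q] on all partial folds gives
    every iteration the same cost bound. *)
Lemma fold_loop c n T m : poly_fun T -> n < m ->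
  (forall z s, s 0 = fold_env z -> exists t s',
     [/\ exec c s t s', s' 0 = fold_step z, forall x, n <= x -> s' x = s x &
         t <= T (tree_size (fold_env z))]) ->
  forall i Z Q (r : seq (A i)) (b : B i) s,
  s 0 = encB b -> s m = enc_seq (@encA i) r -> s m.+1 = e i ->
  tree_size (enc_seq (@encA i) r) <= Z ->
  (forall k, tree_size (encB (foldl (@h i) b (take k r))) <= Q) ->
  exists t s',
   [/\ exec (While (EVar m)
         (Seq (Assign 0 (ENode (EVar 0) (ENode (ELeft (EVar m)) (EVar m.+1))))
         (Seq (Assign m (ERight (EVar m))) c))) s t s',
       s' 0 = encB (foldl (@h i) b r), forall x, m < x -> s' x = s x &
       t <= size r * (T (Q + Z + tree_size (e i) + 2) + 20) + 2].
Proof.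
move=> TP nm H i Z Q; elim=> [|a r IH] b s s0 sm sm1 rZ bQ.
  by exists 2, s; split=> //; apply: (@ExecWhileFalse (EVar m)).
set s1 := [eta s with 0 |-> Node (s 0) (Node (lchild (s m)) (s m.+1))].
set s2 := [eta s1 with m |-> rchild (s1 m)].
pose z : {i : I & (B i * A i)%type} := existT _ i (b, a).
have s20 : s2 0 = fold_env z.
  by rewrite /s2 /s1 /= ifN; [rewrite s0 sm sm1|lia].
have [t [s3 [E3 s3f fr3 t3]]] := H z s2 s20.
have s3m : s3 m = enc_seq (@encA i) r.
  rewrite fr3 /s2 /s1 /= ?eqxx; last lia.
  by rewrite ifN ?sm //; lia.
have frs x : m < x -> s3 x = s x.
  by move=> mx; rewrite fr3 /s2 /s1 /= ?ifN //; lia.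
(* The partial folds of the tail are those of the whole list, shifted by one. *)
have [t' [s4 [E4 s4f fr4 t4]]] := IH (h b a) s3 s3f s3m
  (etrans (frs m.+1 (ltnSn m)) sm1) ltac:(move: rZ; rewrite /=; lia)
  (fun k => bQ k.+1).
exists (1 + (7 + (3 + t)) + t').+1, s4; split=> //.
- apply: (@ExecWhileTrue (EVar m)); last exact: E4; first by rewrite /= sm.
  by apply: ExecSeq (ExecAssign _ _ _) _; apply: ExecSeq (ExecAssign _ _ _) _; exact: E3.
- by move=> x mx; rewrite fr4 // frs.
- have : T (tree_size (fold_env z)) <= T (Q + Z + tree_size (e i) + 2).
    apply: (poly_fun_mono TP); have := bQ 0; move: rZ.
    rewrite take0 /fold_env /=; lia.
  rewrite [size _]/= mulSn; lia.
Qed.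

Lemma size_enc_seq i (r : seq (A i)) : size r < tree_size (enc_seq (@encA i) r).
Proof. by elim: r => //= a r IH; lia. Qed.

(** A polynomial-time body could still double the accumulator at each turn, so a polynomial bound on
    all partial folds is a separate hypothesis. *)
Lemma ptime_fold_bounded Q :
  ptime e (fun i => enc_seq (@encA i) (l i)) ->
  ptime e (fun i => encB (b0 i)) ->
  ptime fold_env fold_step ->
  poly_fun Q ->
  (forall i k,
     tree_size (encB (foldl (@h i) (b0 i) (take k (l i)))) <= Q (tree_size (e i))) ->
  ptime e (fun i => encB (foldl (@h i) (b0 i) (l i))).
Proof.
move=> el eb [c [n [T [TP H]]]] QP bQ.
set f := fun i => Node (enc_seq (@encA i) (l i)) (Node (encB (b0 i)) (e i)).
apply: (@ptime_trans _ _ f).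
  by apply: ptime_node => //; apply: ptime_node => //; apply: ptime_refl.
pose m := n.+1.
exists (Seq (Assign m (ELeft (EVar 0)))
  (Seq (Assign m.+1 (ERight (ERight (EVar 0))))
  (Seq (Assign 0 (ELeft (ERight (EVar 0))))
  (While (EVar m)
         (Seq (Assign 0 (ENode (EVar 0) (ENode (ELeft (EVar m)) (EVar m.+1))))
         (Seq (Assign m (ERight (EVar m))) c)))))).
(* In the constant 13, the three initial assignments cost 11 and the last loop test 2; the summand
   [Q k] covers the size of the output. *)
exists m.+2, (fun k => k * (T (Q k + k + k + 2) + 20) + 13 + Q k); split.
  by poly_fun_tac.
move=> i s s0.
set s1 := [eta s with m |-> lchild (s 0)].
set s2 := [eta s1 with m.+1 |-> rchild (rchild (s1 0))].
set s3 := [eta s2 with 0 |-> lchild (rchild (s2 0))].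
have H' z s' : s' 0 = fold_env z -> exists t s'',
     [/\ exec c s' t s'', s'' 0 = fold_step z, forall x, n <= x -> s'' x = s' x &
         t <= T (tree_size (fold_env z))].
  by move=> /H[t [s'' [? ? ? ? _]]]; exists t, s''.
have eqm : m == m.+1 = false by lia.
have [|||||] := @fold_loop c n T m TP (ltnSn n) H' i (tree_size (f i))
   (Q (tree_size (f i))) (l i) (b0 i) s3.
- by rewrite /s3 /s2 /s1 /= s0.
- by rewrite /s3 /s2 /s1 /= eqxx s0 eqm.
- by rewrite /s3 /s2 /s1 /= eqxx s0.
- by rewrite /=; lia.
- move=> k; apply: (leq_trans (bQ i k)); apply: (poly_fun_mono QP) => /=; lia.
move=> t [s4 [E4 s4f fr4 t4]].
exists (3 + (4 + (4 + t))), s4; split=> //.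
- apply: ExecSeq (ExecAssign _ _ _) _; apply: ExecSeq (ExecAssign _ _ _) _.
  apply: ExecSeq (ExecAssign _ _ _) _; exact: E4.
- by move=> x mx; rewrite fr4 /s3 /s2 /s1 /= ?ifN //; lia.
- have le : size (l i) * (T (Q (tree_size (f i)) + tree_size (f i) + tree_size (e i) + 2) + 20)
    <= tree_size (f i) * (T (Q (tree_size (f i)) + tree_size (f i) + tree_size (f i) + 2) + 20).
    apply: leq_mul; first by rewrite /=; have := size_enc_seq (l i); lia.
    by rewrite leq_add2r; apply: (poly_fun_mono TP); rewrite /=; lia.
  by move: t4 le; set X := (_ * _); set Y := (_ * _); lia.
- have := bQ i (size (l i)); rewrite take_size.
  have : Q (tree_size (e i)) <= Q (tree_size (f i)).
    by apply: (poly_fun_mono QP); rewrite /=; lia.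
  by lia.
Qed.

(** When each step adds an amount that depends only on the element and the context, sizes grow
    additively: by at most [L k * Q (L k + k)] over a list of encoded size at most [L k]. *)
Lemma ptime_fold Q :
  ptime e (fun i => enc_seq (@encA i) (l i)) ->
  ptime e (fun i => encB (b0 i)) ->
  ptime fold_env fold_step ->
  poly_fun Q ->
  (forall i b a,
     tree_size (encB (@h i b a)) <=
       tree_size (encB b) + Q (tree_size (encA a) + tree_size (e i))) ->
  ptime e (fun i => encB (foldl (@h i) (b0 i) (l i))).
Proof.
move=> el eb eh QP hQ.
have [L LP lL] := ptime_size el; have [K KP bK] := ptime_size eb.
apply: (ptime_fold_bounded (Q := fun k => K k + L k * Q (L k + k))) => //.
  by poly_fun_tac.
move=> i k.
suff: forall r (b : B i), tree_size (enc_seq (@encA i) r) <= L (tree_size (e i)) ->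
    tree_size (encB (foldl (@h i) b (take k r))) <=
      tree_size (encB b) + size r * Q (L (tree_size (e i)) + tree_size (e i)).
  move/(_ (l i) (b0 i) (lL i)); move/leq_trans; apply.
  apply: leq_add (bK i) _; apply: leq_mul => //.
  exact: leq_trans (ltnW (size_enc_seq (l i))) (lL i).
elim: k => [|k IH] r b rL; first by rewrite take0 leq_addr.
case: r rL => [|a r] rL; first by rewrite leq_addr.
rewrite /= in rL *; apply: leq_trans (IH _ _ _) _; first lia.
rewrite mulSn addnA leq_add2r; apply: leq_trans (hQ _ _ _) _.
by rewrite leq_add2l; apply: (poly_fun_mono QP); lia.
Qed.

End Fold.

(** * Booleans, numbers and lists *)

Definition enc_bool (b : bool) : tree := if b then Node Leaf Leaf else Leaf.

Definition enc_pair (A B : Type) (encA : A -> tree) (encB : B -> tree)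
  (x : A * B) : tree := Node (encA x.1) (encB x.2).

Definition bound_env (I : Type) (A : I -> Type) (encA : forall i, A i -> tree)
  (e : I -> tree) (z : {i : I & A i}) : tree :=
  Node (encA _ (projT2 z)) (e (projT1 z)).

(** A unary number is a list of units, which turns bounded iteration into a fold. *)
Lemma enc_natE n : enc_nat n = enc_seq (fun _ : unit => Leaf) (nseq n tt).
Proof. by elim: n => //= n ->. Qed.

Lemma tree_size_enc_nat n : tree_size (enc_nat n) = n.*2.+1.
Proof. by elim: n => //= n ->; lia. Qed.

Lemma tree_size_enc_seq (A : Type) (enc : A -> tree) (s : seq A) :
  tree_size (enc_seq enc s) = (sumn [seq (tree_size (enc x)).+1 | x <- s]).+1.
Proof. by elim: s => //= x s ->; lia. Qed.

Lemma tree_size_enc_seq_le (A : eqType) (enc : A -> tree) (s : seq A) (N : nat) :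
  {in s, forall x, tree_size (enc x) <= N} ->
  tree_size (enc_seq enc s) <= (size s * N.+1).+1.
Proof.
rewrite tree_size_enc_seq; elim: s => //= x s IH sN.
have := sN x (mem_head x s).
have := IH (fun y ys => sN y (mem_behead (s := x :: s) ys)); nia.
Qed.

Lemma tree_size_enc_filter (A : Type) (enc : A -> tree) (p : pred A) (s : seq A) :
  tree_size (enc_seq enc (filter p s)) <= tree_size (enc_seq enc s).
Proof. by elim: s => //= x s; case: (p x) => /=; lia. Qed.

Lemma enc_seq_map (A B : Type) (enc : B -> tree) (f : A -> B) (s : seq A) :
  enc_seq enc (map f s) = enc_seq (fun x => enc (f x)) s.
Proof. by elim: s => //= x s ->. Qed.

(** Since elements are encoded by their ranks, enumerating a finite type amounts to counting up to
    its cardinality. *)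
Lemma map_enum_rank (T : finType) :
  [seq nat_of_ord (enum_rank x) | x <- enum T] = iota 0 #|T|.
Proof.
apply: (@eq_from_nth _ 0) => [|i]; first by rewrite size_map size_iota cardE.
rewrite size_map -cardE => lt_i; pose x := enum_val (Ordinal lt_i).
rewrite (nth_map x) -?cardE // nth_iota // add0n.
by rewrite -[i]/(nat_of_ord (Ordinal lt_i)) -enum_val_nth enum_valK.
Qed.

Section Data.
Variables (I : Type) (e : I -> tree).

Lemma ptime_const d : ptime e (fun=> d).
Proof. by elim: d => [|a ea b eb]; [exact: ptime_leaf|exact: ptime_node]. Qed.

Lemma ptime_ifb (b : I -> bool) (f g : I -> tree) :
  ptime e (fun i => enc_bool (b i)) -> ptime e f -> ptime e g ->
  ptime e (fun i => if b i then f i else g i).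
Proof.
move=> eb ef eg; apply: ptime_ext (ptime_if eb ef eg) => i.
by case: (b i).
Qed.

Lemma ptime_is_node (f : I -> tree) :
  ptime e f -> ptime e (fun i => enc_bool (is_node (f i))).
Proof.
by move=> ef; apply: ptime_if => //; apply: ptime_const.
Qed.

Lemma ptime_neg (b : I -> bool) :
  ptime e (fun i => enc_bool (b i)) -> ptime e (fun i => enc_bool (~~ b i)).
Proof.
move=> eb; apply: ptime_ext (ptime_ifb eb (ptime_const Leaf)
  (ptime_const (Node Leaf Leaf))) => i; by case: (b i).
Qed.

Lemma ptime_and (b c : I -> bool) :
  ptime e (fun i => enc_bool (b i)) -> ptime e (fun i => enc_bool (c i)) ->
  ptime e (fun i => enc_bool (b i && c i)).
Proof.
move=> eb ec; apply: ptime_ext (ptime_ifb eb ec (ptime_const Leaf)) => i.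
by case: (b i).
Qed.

Lemma ptime_or (b c : I -> bool) :
  ptime e (fun i => enc_bool (b i)) -> ptime e (fun i => enc_bool (c i)) ->
  ptime e (fun i => enc_bool (b i || c i)).
Proof.
move=> eb ec; apply: ptime_ext (ptime_ifb eb (ptime_const (Node Leaf Leaf)) ec).
by move=> i; case: (b i).
Qed.

Lemma ptime_iter (B : I -> Type) (encB : forall i, B i -> tree)
    (k : I -> nat) (b0 : forall i, B i) (h : forall i, B i -> B i) Q :
  ptime e (fun i => enc_nat (k i)) -> ptime e (fun i => encB i (b0 i)) ->
  ptime (bound_env encB e) (fun z => encB _ (h _ (projT2 z))) ->
  poly_fun Q ->
  (forall i b, tree_size (encB i (h i b)) <= tree_size (encB i b) + Q (tree_size (e i))) ->
  ptime e (fun i => encB i (iter (k i) (h i) (b0 i))).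
Proof.
move=> ek eb eh QP hQ.
have foldE i m b : foldl (fun b (_ : unit) => h i b) b (nseq m tt) = iter m (h i) b.
  by elim: m b => //= m IH b; rewrite IH -iterSr.
apply: (ptime_ext (f := fun i => encB i (foldl (fun b (_ : unit) => h i b) (b0 i)
  (nseq (k i) tt)))) => [i|]; first by rewrite foldE.
apply: (@ptime_fold _ (fun=> unit) B (fun _ _ => Leaf) encB e
  (fun i => nseq (k i) tt) b0 (fun i b _ => h i b) Q) => //.
- by apply: ptime_ext ek => i; rewrite enc_natE.
- set env := fold_env _ _ _; pose phi (z : {i : I & (B i * unit)%type}) :=
    existT B (projT1 z) (projT2 z).1.
  apply: (@ptime_trans _ _ (fun z => bound_env encB e (phi z))).
    apply: ptime_node; first exact: (ptime_left (ptime_refl env)).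
    exact: (ptime_right (ptime_right (ptime_refl env))).
  exact: (ptime_reindex phi eh).
- move=> i b _; apply: (leq_trans (hQ i b)).
  by rewrite leq_add2l; apply: (poly_fun_mono QP); rewrite leq_addl.
Qed.

(** Iterated right children serve both for truncated subtraction of unary numbers and for access to
    a list at a given position. *)
Lemma ptime_iter_rchild (k : I -> nat) (f : I -> tree) :
  ptime e (fun i => enc_nat (k i)) -> ptime e f ->
  ptime e (fun i => iter (k i) rchild (f i)).
Proof.
move=> ek ef.
apply: (@ptime_iter (fun=> tree) (fun _ => id) k f (fun _ => rchild) (fun=> 0)) => //.
- exact: ptime_right (ptime_left (ptime_refl _)).
- exact: poly_fun_const.
- by move=> i [|a b] //=; lia.
Qed.

Lemma ptime_sub (m n : I -> nat) :
  ptime e (fun i => enc_nat (m i)) -> ptime e (fun i => enc_nat (n i)) ->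
  ptime e (fun i => enc_nat (m i - n i)).
Proof.
move=> em en; apply: ptime_ext (ptime_iter_rchild en em) => i.
elim: (n i) => [|k IH] /=; first by rewrite subn0.
by rewrite IH subnS; case: (_ - _).
Qed.

(** Trees cannot be compared directly; two numbers are equal iff both truncated differences
    vanish. *)
Lemma ptime_eqn (m n : I -> nat) :
  ptime e (fun i => enc_nat (m i)) -> ptime e (fun i => enc_nat (n i)) ->
  ptime e (fun i => enc_bool (m i == n i)).
Proof.
move=> em en; have sub_node k : is_node (enc_nat k) = (k != 0) by case: k.
apply: ptime_ext (ptime_and (ptime_neg (ptime_is_node (ptime_sub em en)))
  (ptime_neg (ptime_is_node (ptime_sub en em)))) => i.
by rewrite !sub_node !negbK !subn_eq0 -eqn_leq.
Qed.

Lemma ptime_eq_elt (A : I -> finType) (x y : forall i, A i) :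
  ptime e (fun i => enc_elt (x i)) -> ptime e (fun i => enc_elt (y i)) ->
  ptime e (fun i => enc_bool (x i == y i)).
Proof.
move=> ex ey; apply: ptime_ext (ptime_eqn ex ey) => i.
by rewrite val_eqE (inj_eq enum_rank_inj).
Qed.

Lemma ptime_eq_opt (A : I -> finType) (x y : forall i, option (A i)) :
  ptime e (fun i => enc_opt (@enc_elt _) (x i)) ->
  ptime e (fun i => enc_opt (@enc_elt _) (y i)) ->
  ptime e (fun i => enc_bool (x i == y i)).
Proof.
(* The default 0 is also the rank of the first element, so the constructors are compared separately,
   by [b] below. *)
pose rank i (o : option (A i)) : nat := if o is Some a then enum_rank a else 0.
have rankE i o : enc_nat (rank i o) = lchild (enc_opt (@enc_elt _) o) by case: o.
move=> ex ey.
have er (z : forall i, option (A i)) : ptime e (fun i => enc_opt (@enc_elt _) (z i)) ->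
    ptime e (fun i => enc_nat (rank i (z i))).
  by move=> ez; apply: ptime_ext (ptime_left ez) => i; rewrite rankE.
have e_if := ptime_ifb (ptime_is_node ex) (ptime_is_node ey)
  (ptime_neg (ptime_is_node ey)).
pose b i := if is_node (enc_opt (@enc_elt _) (x i))
   then is_node (enc_opt (@enc_elt _) (y i))
   else ~~ is_node (enc_opt (@enc_elt _) (y i)).
have eb : ptime e (fun i => enc_bool (b i)).
  by apply: ptime_ext e_if => i; rewrite /b; case: is_node.
apply: ptime_ext (ptime_and (ptime_eqn (er x ex) (er y ey)) eb) => i.
rewrite /b; case: (x i) (y i) => [a|] [a'|]; rewrite /= ?andbF //.
by rewrite andbT val_eqE (inj_eq enum_rank_inj).
Qed.

End Data.

Section Lists.
Variables (I : Type) (e : I -> tree) (A : I -> Type) (encA : forall i, A i -> tree).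
Variable l : forall i, seq (A i).
Hypothesis el : ptime e (fun i => enc_seq (@encA i) (l i)).

Lemma ptime_fold_elt (B : I -> Type) (encB : forall i, B i -> tree)
    (g : {i : I & A i} -> tree) :
  ptime (bound_env encA e) g ->
  ptime (fold_env encA encB e) (fun z => g (existT A (projT1 z) (projT2 z).2)).
Proof.
move=> eg; apply: ptime_trans (ptime_reindex _ eg).
exact: (ptime_right (ptime_refl (fold_env encA encB e))).
Qed.

Lemma ptime_fold_acc (B : I -> Type) (encB : forall i, B i -> tree) :
  ptime (fold_env encA encB e) (fun z => encB _ (projT2 z).1).
Proof. exact: (ptime_left (ptime_refl (fold_env encA encB e))). Qed.

Lemma ptime_has (p : forall i, A i -> bool) :
  ptime (bound_env encA e) (fun z => enc_bool (p _ (projT2 z))) ->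
  ptime e (fun i => enc_bool (has (p i) (l i))).
Proof.
move=> ep; have foldE i b s :
    foldl (fun b x => p i x || b) b s = has (p i) s || b.
  by elim: s b => //= x s IH b; rewrite IH orbCA orbA.
apply: (ptime_ext (f := fun i => enc_bool (foldl (fun b x => p i x || b) false (l i)))).
  by move=> i; rewrite foldE orbF.
apply: (@ptime_fold _ A (fun=> bool) encA (fun=> enc_bool) e l (fun=> false)
  (fun i b x => p i x || b) (fun=> 3)) => //.
- exact: ptime_const.
- exact: ptime_or (ptime_fold_elt _ ep) (ptime_fold_acc _).
- exact: poly_fun_const.
- by move=> i b a; case: (_ || _); case: b.
Qed.

(** Folding with cons reverses a list; the loops below build their results backwards and restore the
    order with this. *)
Lemma ptime_rev : ptime e (fun i => enc_seq (@encA i) (rev (l i))).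
Proof.
have foldE i (r s : seq (A i)) : foldl (fun b x => x :: b) r s = catrev s r.
  by elim: s r => /=.
apply: (ptime_ext (f := fun i => enc_seq (@encA i) (foldl (fun b x => x :: b) [::] (l i)))).
  by move=> i; rewrite foldE.
apply: (@ptime_fold _ A (fun i => seq (A i)) encA (fun i => enc_seq (@encA i)) e l
  (fun=> [::]) (fun i b x => x :: b) S) => //.
- exact: ptime_const.
- exact: ptime_node (ptime_fold_elt _ (ptime_left (ptime_refl _))) (ptime_fold_acc _).
- exact: poly_fun_succ poly_fun_id.
- by move=> i b a /=; lia.
Qed.

End Lists.

Section Lists2.
Variables (I : Type) (e : I -> tree) (A B : I -> Type).
Variables (encA : forall i, A i -> tree) (encB : forall i, B i -> tree).
Variables (l : forall i, seq (A i)) (r : forall i, seq (B i)).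
Hypothesis el : ptime e (fun i => enc_seq (@encA i) (l i)).
Hypothesis er : ptime e (fun i => enc_seq (@encB i) (r i)).

Lemma ptime_filter (p : forall i, A i -> bool) :
  ptime (bound_env encA e) (fun z => enc_bool (p _ (projT2 z))) ->
  ptime e (fun i => enc_seq (@encA i) (filter (p i) (l i))).
Proof.
move=> ep; have foldE i (b s : seq (A i)) :
    foldl (fun b x => if p i x then x :: b else b) b s = catrev (filter (p i) s) b.
  by elim: s b => //= x s IH b; rewrite IH; case: (p i x).
apply: (ptime_ext (f := fun i => enc_seq (@encA i) (rev (foldl
  (fun b x => if p i x then x :: b else b) [::] (l i))))).
  by move=> i; rewrite foldE -/(rev _) revK.
apply: ptime_rev.
apply: (@ptime_fold _ A (fun i => seq (A i)) encA (fun i => enc_seq (@encA i)) e l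
  (fun=> [::]) (fun i b x => if p i x then x :: b else b) S) => //.
- exact: ptime_const.
- apply: (ptime_ext (f := fun z : {i : I & (seq (A i) * A i)%type} =>
     if p _ (projT2 z).2
     then enc_seq (@encA _) ((projT2 z).2 :: (projT2 z).1)
     else enc_seq (@encA _) (projT2 z).1)).
    by move=> z; rewrite /fold_step; case: ifP.
  apply: ptime_ifb (ptime_fold_elt _ ep) _ _; last exact: ptime_fold_acc.
  exact: ptime_node (ptime_fold_elt _ (ptime_left (ptime_refl _))) (ptime_fold_acc _ _ _).
- exact: poly_fun_succ poly_fun_id.
- by move=> i b a; case: ifP => _ /=; lia.
Qed.

Lemma ptime_map (f : forall i, A i -> B i) :
  ptime (bound_env encA e) (fun z => encB (f _ (projT2 z))) ->
  ptime e (fun i => enc_seq (@encB i) (map (f i) (l i))).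
Proof.
move=> ef; have [T TP fT] := ptime_size ef.
have foldE i (b : seq (B i)) s :
    foldl (fun b x => f i x :: b) b s = catrev (map (f i) s) b.
  by elim: s b => //= x s IH b; rewrite IH.
apply: (ptime_ext (f := fun i => enc_seq (@encB i) (rev (foldl
  (fun b x => f i x :: b) [::] (l i))))).
  by move=> i; rewrite foldE -/(rev _) revK.
apply: ptime_rev.
apply: (@ptime_fold _ A (fun i => seq (B i)) encA (fun i => enc_seq (@encB i)) e l
  (fun=> [::]) (fun i b x => f i x :: b) (fun k => T (1 + k) + 1)) => //.
- exact: ptime_const.
- exact: ptime_node (ptime_fold_elt _ ef) (ptime_fold_acc _ _ _).
- by poly_fun_tac.
- move=> i b a /=; have := fT (existT A i a); rewrite /bound_env /= add1n; lia.
Qed.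

Lemma ptime_cat (s : forall i, seq (A i)) :
  ptime e (fun i => enc_seq (@encA i) (s i)) ->
  ptime e (fun i => enc_seq (@encA i) (l i ++ s i)).
Proof.
move=> es; have foldE i (b t : seq (A i)) : foldl (fun b x => x :: b) b t = catrev t b.
  by elim: t b => /=.
apply: (ptime_ext (f := fun i => enc_seq (@encA i)
   (foldl (fun b x => x :: b) (s i) (rev (l i))))).
  by move=> i; rewrite foldE catrevE revK.
apply: (@ptime_fold _ A (fun i => seq (A i)) encA (fun i => enc_seq (@encA i)) e
  (fun i => rev (l i)) s (fun i b x => x :: b) S) => //.
- exact: ptime_rev.
- exact: ptime_node (ptime_fold_elt _ (ptime_left (ptime_refl _))) (ptime_fold_acc _ _ _).
- exact: poly_fun_succ poly_fun_id.
- by move=> i b a /=; lia.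
Qed.

End Lists2.

Section Lists3.
Variables (I : Type) (e : I -> tree) (A : I -> Type) (encA : forall i, A i -> tree).

Lemma ptime_flatten (s : forall i, seq (seq (A i))) :
  ptime e (fun i => enc_seq (enc_seq (@encA i)) (s i)) ->
  ptime e (fun i => enc_seq (@encA i) (flatten (s i))).
Proof.
move=> es; have foldE i (b : seq (A i)) t :
    foldl (fun b x => b ++ x) b t = b ++ flatten t.
  by elim: t b => [|x t IH] b /=; rewrite ?cats0 // IH catA.
apply: (ptime_ext (f := fun i => enc_seq (@encA i)
   (foldl (fun b x => b ++ x) [::] (s i)))).
  by move=> i; rewrite foldE.
apply: (@ptime_fold _ (fun i => seq (A i)) (fun i => seq (A i))
  (fun i => enc_seq (@encA i)) (fun i => enc_seq (@encA i)) e s (fun=> [::])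
  (fun i b x => b ++ x) id) => //.
- exact: ptime_const.
- apply: ptime_cat; first exact: ptime_fold_acc.
  exact: (ptime_fold_elt _ (ptime_left (ptime_refl (bound_env _ _)))).
- exact: poly_fun_id.
- by move=> i b a; rewrite !tree_size_enc_seq map_cat sumn_cat; lia.
Qed.

End Lists3.

Section Lists4.
Variables (I : Type) (e : I -> tree) (A B : I -> Type).
Variables (encA : forall i, A i -> tree) (encB : forall i, B i -> tree).

Lemma ptime_allpairs (l : forall i, seq (A i)) (r : forall i, seq (B i)) :
  ptime e (fun i => enc_seq (@encA i) (l i)) ->
  ptime e (fun i => enc_seq (@encB i) (r i)) ->
  ptime e (fun i => enc_seq (enc_pair (@encA i) (@encB i))
     [seq (x, y) | x <- l i, y <- r i]).
Proof.
move=> el er; apply: (@ptime_flatten _ _ (fun i => A i * B i)%type).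
apply: (@ptime_map _ _ _ (fun i => seq (A i * B i)%type) _ _ _ el
  (fun i x => [seq (x, y) | y <- r i])).
set e1 := bound_env _ _.
apply: (@ptime_map _ e1 (fun z => B (projT1 z)) (fun z => A (projT1 z) * B (projT1 z))%type
  (fun z => @encB (projT1 z)) (fun z => enc_pair (@encA _) (@encB _))
  (fun z => r (projT1 z)) _ (fun z y => (projT2 z, y))).
  exact: ptime_weak er.
apply: ptime_node; last exact: ptime_left (ptime_refl _).
exact: (ptime_left (ptime_right (ptime_refl (bound_env _ e1)))).
Qed.

(** The accumulator pairs a counter with the list of its past values. The amount added at each step
    grows with the counter, so [ptime_fold] does not apply and the partial folds are bounded
    explicitly. *)
Lemma ptime_iota (k : I -> nat) :
  ptime e (fun i => enc_nat (k i)) ->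
  ptime e (fun i => enc_seq enc_nat (iota 0 (k i))).
Proof.
move=> ek; have [K KP kK] := ptime_size ek.
pose step (b : nat * seq nat) (_ : unit) := (b.1.+1, b.1 :: b.2).
pose enc := enc_pair enc_nat (enc_seq enc_nat).
have foldE m : foldl step (0, [::]) (nseq m tt) = (m, rev (iota 0 m)).
  elim: m => // m IH.
  by rewrite -addn1 nseqD foldl_cat IH iotaD rev_cat addn1.
apply: (ptime_ext (f := fun i => enc_seq enc_nat (rev
   (foldl step (0, [::]) (nseq (k i) tt)).2))).
  by move=> i; rewrite foldE revK.
apply: ptime_rev.
apply: (@ptime_right _ _ (fun i => enc (foldl step (0, [::]) (nseq (k i) tt)))).
apply: (@ptime_fold_bounded _ (fun=> unit) (fun=> (nat * seq nat)%type)
  (fun _ _ => Leaf) (fun=> enc) e (fun i => nseq (k i) tt) (fun=> (0, [::]))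
  (fun=> step) (fun n => K n + (K n * (K n).+1).+1 + 1)) => //.
- by apply: ptime_ext ek => i; rewrite enc_natE.
- exact: ptime_const.
- set env := fold_env _ _ _.
  have acc : ptime env (fun z => enc (projT2 z).1) by exact: ptime_fold_acc.
  apply: ptime_node; last exact: ptime_node (ptime_left acc) (ptime_right acc).
  exact: ptime_node (ptime_leaf _) (ptime_left acc).
- apply: poly_fun_add (poly_fun_const 1); apply: (poly_fun_add KP).
  exact: poly_fun_succ (poly_fun_mul KP (poly_fun_succ KP)).
move=> i j; have [m le_mk ->] : exists2 m, m <= k i & take j (nseq (k i) tt) = nseq m tt.
  have [le|/ltnW le] := leqP j (k i); first by exists j; rewrite ?take_nseq.
  by exists (k i); rewrite // take_oversize ?size_nseq.
rewrite foldE /enc /enc_pair /= tree_size_enc_nat.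
have := kK i; rewrite tree_size_enc_nat => kKi.
have Nle n : n \in rev (iota 0 m) -> tree_size (enc_nat n) <= K (tree_size (e i)).
  by rewrite mem_rev mem_iota tree_size_enc_nat; lia.
have := tree_size_enc_seq_le Nle; rewrite size_rev size_iota.
have : m * (K (tree_size (e i))).+1 <= K (tree_size (e i)) * (K (tree_size (e i))).+1.
  by rewrite leq_mul2r; lia.
move=> le1 le2; apply: leq_ltn_trans (leq_add (leqnn _) le2) _; lia.
Qed.

Lemma ptime_enum (T : I -> finType) :
  ptime e (fun i => enc_nat #|T i|) ->
  ptime e (fun i => enc_seq (@enc_elt _) (enum (T i))).
Proof.
move=> eT; apply: ptime_ext (ptime_iota eT) => i.
by rewrite -map_enum_rank enc_seq_map.
Qed.

End Lists4.

(** * The decision procedure *)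

Section Procedure.
Variable S : fsa.

(* The first component follows the infinite run, the other two follow the runs
   through the two states of the delayed estimate. *)
Definition triple : finType := (state S * (state S * state S))%type.

(** With the label [None] a copy may also stand still, so the unobservable events of the three
    copies need not be synchronised. *)
Definition lstep (l : option (label S)) (x y : state S) : bool :=
  (l == None) && (x == y) ||
  has (fun r => [&& r.1.1 == x, r.2 == y & labeling r.1.2 == l]) (enum (trans S)).

(* If [solo] holds, then only the first component has to read the label. *)
Definition sync (solo : bool) (l : option (label S)) (r q : triple) : bool :=
  lstep l r.1 q.1 && (solo || lstep l r.2.1 q.2.1 && lstep l r.2.2 q.2.2).

(** Apart from [None], only labels carried by events are tried; no other label can be read by any
    copy. *)
Definition edge (solo obs : bool) (r q : triple) : bool :=
  has (fun l => (obs ==> (l != None)) && sync solo l r q)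
      (None :: map (@labeling S) (enum (event S))).

Definition triples : seq triple :=
  [seq (x, y) | x <- enum (state S),
                y <- [seq (x, y) | x <- enum (state S), y <- enum (state S)]].

Definition image_step (solo obs : bool) (R : seq triple) : seq triple :=
  filter (fun q => has (fun r => edge solo obs r q) R) triples.

(** A shortest path visits each triple at most once, and [edge solo false] is reflexive, so this
    fixed number of rounds reaches everything reachable. *)
Definition closure_step (solo : bool) (R : seq triple) : seq triple :=
  iter (size triples) (image_step solo false) R.

(* The states reached by a word of length at least [k]: an edge in [edge solo true]
   is also one in [edge solo false], so the closures absorb the excess. *)
Definition phase (solo : bool) (k : nat) (R : seq triple) : seq triple :=
  closure_step solo (iter k (fun R => image_step solo true (closure_step solo R)) R).

Definition start : seq triple :=
  [seq (x, y) | x <- enum (init S),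
                y <- [seq (x, y) | x <- enum (init S), y <- enum (init S)]].

Definition bad (Xspec : {set state S * state S}) (k1 k2 : nat) : seq triple :=
  phase true #|state S|
    (phase false k2
       (filter (fun q => has (fun r => (r.1 == q.2.1) && (r.2 == q.2.2)) (enum Xspec))
          (phase false k1 start))).

Definition enc_triple : triple -> tree :=
  enc_pair (@enc_elt _) (enc_pair (@enc_elt _) (@enc_elt _)).

End Procedure.

(** * Running time of the procedure *)

Lemma ptime_length (I : Type) (e : I -> tree) (A : I -> Type)
    (encA : forall i, A i -> tree) (l : forall i, seq (A i)) :
  ptime e (fun i => enc_seq (@encA i) (l i)) ->
  ptime e (fun i => enc_nat (size (l i))).
Proof.
move=> el; apply: (ptime_ext (f := fun i => enc_seq (fun _ : unit => Leaf)
  (map (fun=> tt) (l i)))) => [i|].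
  by rewrite enc_natE; congr enc_seq; elim: (l i) => //= x s ->.
by apply: (ptime_map el); apply: ptime_const.
Qed.

Section Complexity.
Variables (I : Type) (e : I -> tree) (S : I -> fsa).
Hypothesis eS : ptime e (fun i => enc_fsa (S i)).

Lemma ptime_card_state : ptime e (fun i => enc_nat #|state (S i)|).
Proof. exact: ptime_left eS. Qed.

Lemma ptime_init : ptime e (fun i => enc_seq (@enc_elt _) (enum (init (S i)))).
Proof. exact: ptime_left (ptime_right (ptime_right eS)). Qed.

Lemma ptime_enum_trans :
  ptime e (fun i => enc_seq (@enc_trans (S i)) (enum (trans (S i)))).
Proof. exact: ptime_left (ptime_right (ptime_right (ptime_right eS))). Qed.

Lemma ptime_labels :
  ptime e (fun i => enc_seq (enc_opt (@enc_elt _))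
    (map (@labeling (S i)) (enum (event (S i))))).
Proof.
apply: ptime_ext (ptime_right (ptime_right (ptime_right (ptime_right
  (ptime_right eS))))) => i.
by rewrite enc_seq_map.
Qed.

(** The labels are tabulated in the order of [enum], so the label of an event is found by dropping
    as many entries as the rank of the event. *)
Lemma ptime_labeling (t : forall i, event (S i)) :
  ptime e (fun i => enc_elt (t i)) ->
  ptime e (fun i => enc_opt (@enc_elt _) (labeling (t i))).
Proof.
move=> et; apply: ptime_ext (ptime_left (ptime_iter_rchild et ptime_labels)) => i.
rewrite enc_seq_map.
have dropE (A : Type) (enc : A -> tree) n s :
    iter n rchild (enc_seq enc s) = enc_seq enc (drop n s).
  elim: n s => [|n IH] s; first by rewrite drop0.
  by rewrite iterSr; case: s => [|x s]; [apply: etrans (IH [::]) _; case: n {IH}|exact: IH].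
rewrite dropE (drop_nth (t i)); last by rewrite -cardE.
by rewrite /= -enum_val_nth enum_rankK.
Qed.

End Complexity.

Section ComplexityEdge.
Variables (I : Type) (e : I -> tree) (S : I -> fsa).
Hypothesis eS : ptime e (fun i => enc_fsa (S i)).

Lemma ptime_lstep (l : forall i, option (label (S i))) (x y : forall i, state (S i)) :
  ptime e (fun i => enc_opt (@enc_elt _) (l i)) ->
  ptime e (fun i => enc_elt (x i)) -> ptime e (fun i => enc_elt (y i)) ->
  ptime e (fun i => enc_bool (lstep (l i) (x i) (y i))).
Proof.
move=> el ex ey; apply: ptime_or.
  apply: ptime_and (ptime_eq_elt ex ey).
  by apply: (ptime_eq_opt el (y := fun=> None)); apply: ptime_const.
apply: (ptime_has (ptime_enum_trans eS)).
set e1 := bound_env _ _.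
have er : ptime e1 (fun z => enc_trans (projT2 z)) by apply: ptime_left (ptime_refl _).
have e1S : ptime e1 (fun z => enc_fsa (S (projT1 z))) := ptime_weak _ _ eS.
apply: ptime_and; last apply: ptime_and.
- apply: (ptime_eq_elt (A := fun z => state (S (projT1 z)))); first exact: ptime_left er.
  exact: (ptime_weak (@projT1 _ _) _ ex).
- apply: (ptime_eq_elt (A := fun z => state (S (projT1 z)))).
    exact: ptime_right (ptime_right er).
  exact: (ptime_weak (@projT1 _ _) _ ey).
- apply: (ptime_eq_opt (A := fun z => label (S (projT1 z)))); last first.
    exact: (ptime_weak (@projT1 _ _) _ el).
  exact: (ptime_labeling e1S (ptime_left (ptime_right er))).
Qed.

Lemma ptime_sync solo (l : forall i, option (label (S i)))
    (r q : forall i, triple (S i)) :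
  ptime e (fun i => enc_opt (@enc_elt _) (l i)) ->
  ptime e (fun i => enc_triple (r i)) -> ptime e (fun i => enc_triple (q i)) ->
  ptime e (fun i => enc_bool (sync solo (l i) (r i) (q i))).
Proof.
move=> el er eq; apply: ptime_and.
  exact: ptime_lstep el (ptime_left er) (ptime_left eq).
case: solo; first exact: ptime_const.
apply: ptime_and.
  exact: ptime_lstep el (ptime_left (ptime_right er)) (ptime_left (ptime_right eq)).
exact: ptime_lstep el (ptime_right (ptime_right er)) (ptime_right (ptime_right eq)).
Qed.

Lemma ptime_triples : ptime e (fun i => enc_seq (@enc_triple (S i)) (triples (S i))).
Proof.
have eX := ptime_enum (ptime_card_state eS).
exact: (ptime_allpairs eX (ptime_allpairs eX eX)).
Qed.

Lemma ptime_start : ptime e (fun i => enc_seq (@enc_triple (S i)) (start (S i))).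
Proof.
have eX := ptime_init eS.
exact: (ptime_allpairs eX (ptime_allpairs eX eX)).
Qed.

End ComplexityEdge.

Lemma ptime_edge (I : Type) (e : I -> tree) (S : I -> fsa) solo obs
    (r q : forall i, triple (S i)) :
  ptime e (fun i => enc_fsa (S i)) ->
  ptime e (fun i => enc_triple (r i)) -> ptime e (fun i => enc_triple (q i)) ->
  ptime e (fun i => enc_bool (edge solo obs (r i) (q i))).
Proof.
move=> eS er eq.
apply: (ptime_has (A := fun i => option (label (S i)))
  (encA := fun i => enc_opt (@enc_elt _))).
  by apply: ptime_node (ptime_labels eS); apply: ptime_const.
set e1 := bound_env _ _.
have e1S : ptime e1 (fun z => enc_fsa (S (projT1 z))) := ptime_weak _ _ eS.
have el : ptime e1 (fun z => enc_opt (@enc_elt _) (projT2 z)).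
  exact: (ptime_left (ptime_refl e1)).
apply: ptime_and.
  case: obs => /=; last exact: ptime_const.
  apply: ptime_neg; apply: (ptime_eq_opt (A := fun z => label (S (projT1 z))) el).
  exact: ptime_const.
apply: (ptime_sync e1S _ el); first exact: (ptime_weak (@projT1 _ _) _ er).
exact: (ptime_weak (@projT1 _ _) _ eq).
Qed.

Lemma ptime_image (I : Type) (e : I -> tree) (S : I -> fsa) solo obs
    (R : forall i, seq (triple (S i))) :
  ptime e (fun i => enc_fsa (S i)) ->
  ptime e (fun i => enc_seq (@enc_triple (S i)) (R i)) ->
  ptime e (fun i => enc_seq (@enc_triple (S i)) (image_step solo obs (R i))).
Proof.
move=> eS eR; apply: (ptime_filter (ptime_triples eS)).
set e1 := bound_env _ _.
have e1S : ptime e1 (fun z => enc_fsa (S (projT1 z))) := ptime_weak _ _ eS.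
have eq : ptime e1 (fun z => enc_triple (projT2 z)).
  exact: (ptime_left (ptime_refl e1)).
apply: (ptime_has (A := fun z => triple (S (projT1 z))) (ptime_weak _ _ eR)
  (p := fun z r => edge solo obs r (projT2 z))).
set e2 := bound_env _ e1.
apply: (@ptime_edge _ e2 (fun z => S (projT1 (projT1 z))) solo obs
  (fun z => projT2 z) (fun z => projT2 (projT1 z))).
- exact: (ptime_weak (@projT1 _ _) _ e1S).
- exact: (ptime_left (ptime_refl e2)).
- exact: (ptime_weak (@projT1 _ _) _ eq).
Qed.

Lemma tree_size_image (S : fsa) solo obs (R : seq (triple S)) :
  tree_size (enc_seq (@enc_triple S) (image_step solo obs R)) <=
  tree_size (enc_seq (@enc_triple S) (triples S)).
Proof. exact: tree_size_enc_filter. Qed.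

(** Every image is a sublist of [triples], whatever the accumulator was, so its size stays bounded.
    Taking the identity for [f] gives the closure, and taking the closure gives the phase. *)
Lemma ptime_iter_image (I : Type) (e : I -> tree) (S : I -> fsa) solo obs
    (f : forall i, seq (triple (S i)) -> seq (triple (S i)))
    (k : I -> nat) (R : forall i, seq (triple (S i))) :
  ptime e (fun i => enc_fsa (S i)) -> ptime e (fun i => enc_nat (k i)) ->
  ptime e (fun i => enc_seq (@enc_triple (S i)) (R i)) ->
  ptime (bound_env (fun i => enc_seq (@enc_triple (S i))) e)
    (fun z => enc_seq (@enc_triple _) (f _ (projT2 z))) ->
  ptime e (fun i => enc_seq (@enc_triple (S i))
     (iter (k i) (fun R => image_step solo obs (f i R)) (R i))).
Proof.
move=> eS ek eR ef; have [T TP tT] := ptime_size (ptime_triples eS).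
apply: (@ptime_iter I e (fun i => seq (triple (S i))) (fun i => enc_seq (@enc_triple (S i)))
  k R (fun i R => image_step solo obs (f i R)) T) => //.
  exact: (ptime_image (S := fun z => S (projT1 z)) _ _ (ptime_weak _ _ eS) ef).
move=> i b; apply: leq_trans (leq_addl _ _).
exact: leq_trans (tree_size_image _ _ _) (tT i).
Qed.

Lemma ptime_closure (I : Type) (e : I -> tree) (S : I -> fsa) solo
    (R : forall i, seq (triple (S i))) :
  ptime e (fun i => enc_fsa (S i)) ->
  ptime e (fun i => enc_seq (@enc_triple (S i)) (R i)) ->
  ptime e (fun i => enc_seq (@enc_triple (S i)) (closure_step solo (R i))).
Proof.
move=> eS eR.
apply: (ptime_iter_image (f := fun i => id) solo false eS) => //.
  exact: ptime_length (ptime_triples eS).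
exact: ptime_left (ptime_refl _).
Qed.

Lemma ptime_phase (I : Type) (e : I -> tree) (S : I -> fsa) solo (k : I -> nat)
    (R : forall i, seq (triple (S i))) :
  ptime e (fun i => enc_fsa (S i)) -> ptime e (fun i => enc_nat (k i)) ->
  ptime e (fun i => enc_seq (@enc_triple (S i)) (R i)) ->
  ptime e (fun i => enc_seq (@enc_triple (S i)) (phase solo (k i) (R i))).
Proof.
move=> eS ek eR; apply: (ptime_closure _ eS).
apply: (ptime_iter_image (f := fun i => @closure_step (S i) solo) _ _ eS ek eR).
exact: (ptime_closure (S := fun z => S (projT1 z)) _ (ptime_weak _ _ eS)
  (ptime_left (ptime_refl (bound_env _ e)))).
Qed.

(** Bundling the data of an instance yields the index type over which the whole procedure is in
    [ptime]. *)
Record instance := Instance {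
  inst_fsa : fsa;
  inst_spec : {set state inst_fsa * state inst_fsa};
  inst_k1 : nat;
  inst_k2 : nat
}.

Definition enc_instance (i : instance) : tree :=
  enc_input (inst_spec i) (inst_k1 i) (inst_k2 i).

Lemma ptime_bad : ptime enc_instance
  (fun i => enc_seq (@enc_triple _) (bad (inst_spec i) (inst_k1 i) (inst_k2 i))).
Proof.
have eS : ptime enc_instance (fun i => enc_fsa (inst_fsa i)).
  exact: (ptime_left (ptime_refl enc_instance)).
have eX : ptime enc_instance (fun i => enc_spec (inst_spec i)).
  exact: (ptime_left (ptime_right (ptime_refl enc_instance))).
have ek1 : ptime enc_instance (fun i => enc_nat (inst_k1 i)).
  exact: (ptime_left (ptime_right (ptime_right (ptime_refl enc_instance)))).
have ek2 : ptime enc_instance (fun i => enc_nat (inst_k2 i)).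
  exact: (ptime_right (ptime_right (ptime_right (ptime_refl enc_instance)))).
apply: (ptime_phase _ eS (ptime_card_state eS)); apply: (ptime_phase _ eS ek2).
apply: (ptime_filter (A := fun i => triple (inst_fsa i))
  (ptime_phase _ eS ek1 (ptime_start eS))).
set e1 := bound_env _ _.
have eq : ptime e1 (fun z => enc_triple (projT2 z)).
  exact: (ptime_left (ptime_refl e1)).
apply: (@ptime_has _ e1
  (fun z => state (inst_fsa (projT1 z)) * state (inst_fsa (projT1 z)))%type _ _
  (ptime_weak _ _ eX) (fun z r => (r.1 == (projT2 z).2.1) && (r.2 == (projT2 z).2.2))).
set e2 := bound_env _ e1.
have er : ptime e2 (fun z => Node (enc_elt (projT2 z).1) (enc_elt (projT2 z).2)).
  exact: (ptime_left (ptime_refl e2)).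
have eq2 : ptime e2 (fun z => enc_triple (projT2 (projT1 z))).
  exact: (ptime_weak (@projT1 _ _) _ eq).
apply: ptime_and; apply: (ptime_eq_elt (A := fun z => state (inst_fsa (projT1 (projT1 z))))).
- exact: ptime_left er.
- exact: ptime_left (ptime_right eq2).
- exact: ptime_right er.
- exact: ptime_right (ptime_right eq2).
Qed.

(** * Correctness *)

Section Words.
Variable S : fsa.
Implicit Types (x y z : state S) (w : seq (label S)) (r q : triple S).

Definition reads w x y : Prop := exists s, label_word s = w /\ run x s y.

Lemma label_word_cat (s1 s2 : seq (event S)) :
  label_word (s1 ++ s2) = label_word s1 ++ label_word s2.
Proof. exact: pmap_cat. Qed.

Lemma run_cat x z (s1 s2 : seq (event S)) :
  run x (s1 ++ s2) z <-> exists2 y, run x s1 y & run y s2 z.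
Proof.
elim: s1 x => [|t s1 IH] x /=.
  by split=> [?|[y ->]] //; exists x.
split=> [[y [xy /IH[y' ? ?]]]|[y [y' [? ?] ?]]].
  by exists y' => //; exists y.
by exists y'; split=> //; apply/IH; exists y.
Qed.

Lemma reads_cat w1 w2 x y z :
  reads w1 x y -> reads w2 y z -> reads (w1 ++ w2) x z.
Proof.
move=> [s1 [<- ?]] [s2 [<- ?]]; exists (s1 ++ s2).
by rewrite label_word_cat; split=> //; apply/run_cat; exists y.
Qed.

(** The run is cut just before the event that emits the first letter of [w2], or at its end if [w2]
    is empty. *)
Lemma reads_split w1 w2 x z :
  reads (w1 ++ w2) x z -> exists2 y, reads w1 x y & reads w2 y z.
Proof.
case=> s []; elim: s w1 x => [|t s IH] w1 x /=.
  by case: w1 => //= <- ->; exists z; exists [::].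
case lt: (labeling t) => [a|] /= eq_w [y [xy yz]].
  case: w1 eq_w => [|b w1] /= eq_w.
    by exists x; [exists [::]|exists (t :: s); rewrite /= lt; split=> //; exists y].
  case: eq_w lt => -> eq_w lt.
  have [y' [s' [<- ?]] ?] := IH _ _ eq_w yz; exists y' => //.
  by exists (t :: s'); rewrite /= lt; split=> //; exists y.
have [y' [s' [<- ?]] ?] := IH _ _ eq_w yz; exists y' => //.
by exists (t :: s'); rewrite /= lt; split=> //; exists y.
Qed.

Lemma lstepP l x y :
  reflect (l = None /\ x = y \/ exists2 t, (x, t, y) \in trans S & labeling t = l)
          (lstep l x y).
Proof.
apply: (iffP orP) => [[/andP[/eqP-> /eqP->]|/hasP[[[x' t] y']]]|[[-> ->]|[t xty <-]]].
- by left.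
- rewrite mem_enum => xty /and3P[/= /eqP<- /eqP<- /eqP<-].
  by right; exists t.
- by left; rewrite !eqxx.
- by right; apply/hasP; exists (x, t, y); rewrite ?mem_enum //= !eqxx.
Qed.

Lemma lstep_refl x : lstep None x x.
Proof. by rewrite /lstep !eqxx. Qed.

Lemma lstep_reads l x y : lstep l x y -> reads (seq_of_opt l) x y.
Proof.
case/lstepP=> [[-> ->]|[t xty <-]]; first by exists [::].
exists [:: t]; split; first by rewrite /label_word /=; case: labeling.
by exists y.
Qed.

Lemma reads_nil x y : reads [::] x y -> connect (lstep None) x y.
Proof.
case=> s []; elim: s x => [|t s IH] x /=; first by move=> _ ->.
case lt: (labeling t) => [//|] /= sw [x' [xx' /IH-/(_ sw)]].
by apply: connect_trans; apply/connect1/lstepP; right; exists t.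
Qed.

Lemma reads_cons a w x y : reads (a :: w) x y ->
  exists x1 x2, [/\ connect (lstep None) x x1, lstep (Some a) x1 x2 & reads w x2 y].
Proof.
case=> s []; elim: s x => [//|t s IH] x /=.
case lt: (labeling t) => [b|] /= sw [x' [xx' x'y]].
  case: sw lt => -> sw lt; exists x, x'; split=> //; last by exists s.
  by apply/lstepP; right; exists t.
have [x1 [x2 [x'x1 ? ?]]] := IH _ sw x'y; exists x1, x2; split=> //.
by apply: connect_trans x'x1; apply/connect1/lstepP; right; exists t.
Qed.

(** * Joint runs of three copies as walks in the product *)

Definition reads3 (solo : bool) w r q : Prop :=
  reads w r.1 q.1 /\ (solo \/ reads w r.2.1 q.2.1 /\ reads w r.2.2 q.2.2).

Lemma reads3_cat solo w1 w2 r1 r2 r3 :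
  reads3 solo w1 r1 r2 -> reads3 solo w2 r2 r3 -> reads3 solo (w1 ++ w2) r1 r3.
Proof.
move=> [a [?|[b c]]] [a' s']; split; try exact: reads_cat a a'; first by left.
case: s' => [?|[b' c']]; first by left.
by right; split; [exact: reads_cat b b'|exact: reads_cat c c'].
Qed.

Lemma reads3_nil solo r : reads3 solo [::] r r.
Proof. by split; [exists [::]|right; split; exists [::]]. Qed.

(** A label other than [None] is among those tried by [edge], because the first component takes a
    transition that carries it. *)
Lemma sync_edge solo obs l r q :
  sync solo l r q -> (obs ==> (l != None)) -> edge solo obs r q.
Proof.
move=> rq obs_l; apply/hasP; exists l; last by rewrite obs_l.
case: l rq {obs_l} => [a|]; rewrite inE //= => /andP[/lstepP[[]|[t _ <-]]] // _.
by apply/mapP; exists t; rewrite ?mem_enum.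
Qed.

Lemma edge_reads solo obs r q : edge solo obs r q ->
  exists2 w, reads3 solo w r q & (obs -> 0 < size w).
Proof.
case/hasP=> l _ /andP[/implyP obs_l /andP[a bc]]; exists (seq_of_opt l).
  split; first exact: lstep_reads.
  case/orP: bc => [?|/andP[b c]]; first by left.
  by right; split; exact: lstep_reads.
by case: l obs_l {a bc} => // obs_l /obs_l.
Qed.

Lemma edge_refl solo r : edge solo false r r.
Proof. by apply: (sync_edge (l := None)); rewrite // /sync !lstep_refl orbT. Qed.

Lemma edge_weaken solo obs r q : edge solo obs r q -> edge solo false r q.
Proof. by case/hasP=> l lS /andP[_ ?]; apply/hasP; exists l. Qed.

Lemma connect_lift (f : state S -> triple S) (e : rel (triple S)) :
  (forall x y, lstep None x y -> e (f x) (f y)) ->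
  forall x y, connect (lstep None) x y -> connect e (f x) (f y).
Proof.
move=> fe x _ /connectP[p xp ->]; elim: p x xp => //= y p IH x /andP[xy /IH].
by apply: connect_trans; apply/connect1/fe.
Qed.

(** The components move one after the other, the remaining ones standing still meanwhile. *)
Lemma silent_connect (solo : bool) r q :
  connect (lstep None) r.1 q.1 ->
  solo \/ connect (lstep None) r.2.1 q.2.1 /\ connect (lstep None) r.2.2 q.2.2 ->
  connect (edge solo false) r q.
Proof.
case: r q => [a [b c]] [a' [b' c']] /= aa' bc.
apply: (@connect_trans _ _ (a', (b, c))).
  apply: (connect_lift (f := fun x => (x, (b, c)))) aa' => x y xy.
  by apply: (sync_edge (l := None)); rewrite // /sync xy !lstep_refl orbT.
(* In solo mode the last two components are unconstrained, so a single edge takes both to their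
   targets. *)
case: bc => [solo1|[bb' cc']].
  by apply/connect1/(sync_edge (l := None)); rewrite // /sync solo1 lstep_refl.
apply: (@connect_trans _ _ (a', (b', c))).
  apply: (connect_lift (f := fun x => (a', (x, c)))) bb' => x y xy.
  by apply: (sync_edge (l := None)); rewrite // /sync xy !lstep_refl orbT.
apply: (connect_lift (f := fun x => (a', (b', x)))) cc' => x y xy.
by apply: (sync_edge (l := None)); rewrite // /sync xy !lstep_refl orbT.
Qed.

(** The [k] marked edges carry labels, but the paths in [edge solo false] between them may do so
    too: the walk crosses at least [k] labelled edges. *)
Fixpoint walk solo k r q : Prop :=
  if k is k'.+1 then exists r1 r2,
    [/\ connect (edge solo false) r r1, edge solo true r1 r2 & walk solo k' r2 q]
  else connect (edge solo false) r q.

Lemma walk_reads solo k r q : walk solo k r q ->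
  exists2 w, reads3 solo w r q & k <= size w.
Proof.
have conn r' q' : connect (edge solo false) r' q' -> exists w, reads3 solo w r' q'.
  case/connectP=> p; elim: p r' => [|r1 p IH] r' /=.
    by move=> _ ->; exists [::]; exact: reads3_nil.
  move=> /andP[/edge_reads[w rw _] /IH{}IH] /IH[w' rw'].
  by exists (w ++ w'); apply: reads3_cat rw rw'.
elim: k r => [|k IH] r /=; first by case/conn=> w ?; exists w.
move=> [r1 [r2 [/conn[w1 rw1] /edge_reads[w2 rw2 /(_ isT) w2_gt0] /IH[w3 rw3 kw3]]]].
exists (w1 ++ w2 ++ w3); last by rewrite !size_cat; lia.
exact: reads3_cat rw1 (reads3_cat rw2 rw3).
Qed.

(** Each letter of [w] gives a labelled edge. The first [k] become the marked edges; the remaining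
    ones are weakened and absorbed by the final path. *)
Lemma reads_walk solo k w r q : reads3 solo w r q -> k <= size w -> walk solo k r q.
Proof.
elim: w k r => [|a w IH] k r [r1 r2].
  rewrite leqn0 => /eqP->; apply: silent_connect; first exact: reads_nil.
  by case: r2 => [|[? ?]]; [left|right; split; exact: reads_nil].
have [x1 [x2 [rx1 x12 x2q]]] := reads_cons r1.
have [u [v [ru uv vq]]] : exists u v, [/\ connect (edge solo false) r u,
    sync solo (Some a) u v & reads3 solo w v q].
  case: r2 => [solo1|[r2 r3]].
    exists (x1, r.2), (x2, r.2); rewrite /sync /= solo1 x12; split=> //.
      by apply: silent_connect => //=; left.
    by split=> //; left.
  have [y1 [y2 [ry1 y12 y2q]]] := reads_cons r2.
  have [z1 [z2 [rz1 z12 z2q]]] := reads_cons r3.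
  exists (x1, (y1, z1)), (x2, (y2, z2)); rewrite /sync /= x12 y12 z12 orbT.
  by split=> //; [apply: silent_connect => //=; right|split=> //; right].
have uve : edge solo true u v by exact: sync_edge uv _.
case: k => [_|k kw] /=; last by exists u, v; split=> //; exact: IH.
apply: connect_trans ru _; apply: connect_trans (connect1 (edge_weaken uve)) _.
exact: (IH 0).
Qed.

(** * The sets of triples that the procedure computes *)

Lemma mem_triples r : r \in triples S.
Proof.
case: r => a [b c]; apply/allpairsP; exists (a, (b, c)); rewrite mem_enum; split=> //.
by apply/allpairsP; exists (b, c); rewrite !mem_enum.
Qed.

Lemma mem_image solo obs R q :
  (q \in image_step solo obs R) = has (fun r => edge solo obs r q) R.
Proof. by rewrite mem_filter mem_triples andbT. Qed.

Lemma mem_closure solo R q :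
  q \in closure_step solo R <-> exists2 r, r \in R & connect (edge solo false) r q.
Proof.
have iterP n q' : q' \in iter n (image_step solo false) R <->
    exists r p, [/\ r \in R, path (edge solo false) r p, size p = n & q' = last r p].
  elim: n q' => [|n IH] q' /=.
    split=> [?|[r [p [rR _ /size0nil-> ->]]]] //.
    by exists q', [::].
  rewrite mem_image; split=> [/hasP[q1 /IH[r [p [rR rp <- ->]]] q1q']|].
    by exists r, (rcons p q'); rewrite rcons_path rp size_rcons last_rcons.
  case=> r [p [rR]]; case/lastP: p => // p q2.
  rewrite rcons_path size_rcons last_rcons => /andP[rp pq] [szp] ->.
  by apply/hasP; exists (last r p) => //; apply/IH; exists r, p.
split=> [/iterP[r [p [rR rp _ ->]]]|[r rR /connectP[p0 rp0 ->]]].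
  by exists r => //; apply/connectP; exists p.
case/shortenP: rp0 => p rp uniq_p _; apply/iterP.
have le_p : size p <= size (triples S).
  by apply: ltnW; apply: (uniq_leq_size uniq_p) => ? _; exact: mem_triples.
(* The repetition-free path is padded by loops at its end to the exact number of iterations. *)
exists r, (p ++ nseq (size (triples S) - size p) (last r p)); split=> //.
- by rewrite cat_path rp; elim: (_ - _) => //= m ->; rewrite edge_refl.
- by rewrite size_cat size_nseq subnKC.
- by rewrite last_cat; elim: (_ - _).
Qed.

Lemma mem_phase solo k R q :
  q \in phase solo k R <-> exists2 r, r \in R & walk solo k r q.
Proof.
rewrite /phase; elim: k R => [|k IH] R; first exact: mem_closure.
rewrite iterSr IH; split.
  move=> [r2]; rewrite mem_image => /hasP[r1 /mem_closure[r rR rr1] r12] r2q.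
  by exists r => //; exists r1, r2.
case=> r rR [r1 [r2 [rr1 r12 r2q]]]; exists r2 => //.
by rewrite mem_image; apply/hasP; exists r1 => //; apply/mem_closure; exists r.
Qed.

Lemma delayed_estimateP w1 w2 x : delayed_estimate w1 w2 x <->
  exists x0 x', [/\ x0 \in init S, reads w1 x0 x & reads w2 x x'].
Proof.
split=> [[x0 [x' [s1 [s2 [? ? ? ? ?]]]]]|[x0 [x' [? [s1 [? ?]] [s2 [? ?]]]]]].
  by exists x0, x'; split=> //; [exists s1|exists s2].
by exists x0, x', s1, s2.
Qed.

(** A finite certificate of failure: [w3] stands for the infinite continuation of the run that
    starts in [a0], and the two estimates come from runs of their own. *)
Definition witness (Xspec : {set state S * state S}) (k1 k2 : nat) : Prop :=
  exists w1 w2 w3 a0 a1 a2 a3 x y,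
    [/\ [/\ a0 \in init S, reads w1 a0 a1, reads w2 a1 a2 & reads w3 a2 a3],
        [/\ k1 <= size w1, k2 <= size w2 & #|state S| <= size w3] &
        [/\ delayed_estimate w1 w2 x, delayed_estimate w1 w2 y & (x, y) \in Xspec]].

Lemma badP Xspec k1 k2 :
  witness Xspec k1 k2 <-> exists q, q \in bad Xspec k1 k2.
Proof.
split=> [[w1 [w2 [w3 [a0 [a1 [a2 [a3 [x [y [[a0i w1a w2a w3a] [kw1 kw2 kw3]]]]]]]]]]]|].
  case=> /delayed_estimateP[b0 [b' [b0i w1b w2b]]].
  move=> /delayed_estimateP[c0 [c' [c0i w1c w2c]]] xyX.
  (* In the last phase the second and third components are free; they are left where they are. *)
  exists (a3, (b', c')); apply/mem_phase; exists (a2, (b', c')); last first.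
    by apply: (reads_walk (w := w3)) => //; split=> //; left.
  apply/mem_phase; exists (a1, (x, y)); last first.
    by apply: (reads_walk (w := w2)) => //; split=> //; right.
  rewrite mem_filter; apply/andP; split.
    by apply/hasP; exists (x, y); rewrite ?mem_enum //= !eqxx.
  apply/mem_phase; exists (a0, (b0, c0)); last first.
    by apply: (reads_walk (w := w1)) => //; split=> //; right.
  apply/allpairsP; exists (a0, (b0, c0)); rewrite mem_enum; split=> //.
  by apply/allpairsP; exists (b0, c0); rewrite !mem_enum.
case=> q3 /mem_phase[q2 /mem_phase[q1]]; rewrite mem_filter.
move=> /andP[/hasP[[x y]]]; rewrite mem_enum => xyX /= /andP[/eqP qx /eqP qy].
case/mem_phase=> q0 /allpairsP[[a0 bc0] [/= a0i /allpairsP[[b0 c0] [/= b0i c0i ->]] ->]].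
case/walk_reads=> w1 [w1a [//|[w1b w1c]]] kw1.
case/walk_reads=> w2 [w2a [//|[w2b w2c]]] kw2.
case/walk_reads=> w3 [w3a _] kw3.
rewrite !mem_enum /= in a0i b0i c0i w1a w1b w1c.
exists w1, w2, w3, a0, q1.1, q2.1, q3.1, x, y; split=> //; split=> //.
  by apply/delayed_estimateP; exists b0, q2.2.1; rewrite qx.
by apply/delayed_estimateP; exists c0, q2.2.2; rewrite qy.
Qed.

End Words.

(** * Infinite runs *)

Section Infinite.
Variable S : fsa.
Implicit Types (x y z : state S) (w : seq (label S)).

Lemma mkseqSl (A : Type) (f : nat -> A) n :
  mkseq f n.+1 = f 0 :: mkseq (fun i => f i.+1) n.
Proof. by rewrite /mkseq /= -[1]addn0 iotaDl -map_comp. Qed.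

Lemma mkseqD (A : Type) (f : nat -> A) m n :
  mkseq f (m + n) = mkseq f m ++ mkseq (fun i => f (m + i)) n.
Proof. by rewrite /mkseq iotaD map_cat add0n -[X in iota X n]addn0 iotaDl -map_comp. Qed.

(** The words of the finite prefixes extend one another, so letter [n] can be read off any prefix
    that has emitted more than [n] labels. *)
Lemma exists_omega_label (t : nat -> event S) :
  (forall n, exists m, n <= size (label_word (mkseq t m))) ->
  exists sigma, omega_label t sigma.
Proof.
move=> inf; have [a _] : exists a : label S, True.
  by have [m] := inf 1; case: label_word => // a; exists a.
pose W m := label_word (mkseq t m).
have nthW m m' i : i < size (W m) -> i < size (W m') -> nth a (W m) i = nth a (W m') i.
  wlog le_mm' : m m' / m <= m'.
    by move=> IH; case/orP: (leq_total m m') => /IH // H *; apply/esym/H.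
  rewrite /W -(subnKC le_mm') mkseqD label_word_cat => im _.
  by rewrite nth_cat im.
exists (fun n => nth a (W (ex_minn (inf n.+1))) n); split=> // m.
rewrite /omega_prefix -/(W m); apply: (@eq_from_nth _ a); first by rewrite size_mkseq.
move=> i im; rewrite nth_mkseq //; apply: nthW => //.
by case: ex_minnP.
Qed.

(** * Unrolling a lasso into an infinite run *)

Definition transition : Type := (state S * event S * state S)%type.

(** Recording a run by its transitions makes the visited states available as data, which [run] hides
    behind existentials. *)
Fixpoint chain x (c : seq transition) y : Prop :=
  if c is r :: c' then [/\ r.1.1 = x, r \in trans S & chain r.2 c' y] else x = y.

Lemma run_chain x s y : run x s y ->
  exists2 c, chain x c y & map (fun r : transition => r.1.2) c = s.
Proof.
elim: s x => [|t s IH] x /=; first by exists [::].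
by case=> x' [xx' /IH[c ? <-]]; exists ((x, t, x') :: c).
Qed.

Section Lasso.
Variables (y : state S) (r0 : transition) (v : seq transition).
Hypothesis v_cycle : chain y (r0 :: v) y.
Hypothesis v_label : label_word (map (fun r : transition => r.1.2) (r0 :: v)) <> [::].

(** The list holds the transitions still to be taken, and the cycle is reloaded when the last one is
    consumed. The result is never empty, so from a nonempty list the default of [head] in [unroll]
    is never reached. *)
Definition advance (c : seq transition) : seq transition :=
  if behead c is r :: c' then r :: c' else r0 :: v.

Definition unroll (c : seq transition) (i : nat) : transition :=
  head r0 (iter i advance c).

Lemma unroll_prefix r c :
  iter (size (r :: c)) advance (r :: c) = r0 :: v /\
  mkseq (unroll (r :: c)) (size (r :: c)) = r :: c.
Proof.
elim: c r => [|r' c IH] r //; have [IH1 IH2] := IH r'.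
split; first by rewrite iterSr.
rewrite [size _]/= mkseqSl -[in RHS]IH2; congr cons.
by apply: eq_map => i; rewrite /unroll iterSr.
Qed.

Lemma unroll_loop r c n :
  mkseq (unroll (r :: c)) (size (r :: c) + n) = r :: c ++ mkseq (unroll (r0 :: v)) n.
Proof.
have [it mk] := unroll_prefix r c; rewrite mkseqD mk /=; congr (_ :: _ ++ _).
by apply: eq_map => i; rewrite /unroll addnC iterD it.
Qed.

(** The remaining list is always a chain that ends in [y], where the reloaded cycle starts. *)
Lemma unroll_trans x c i : c <> [::] -> chain x c y ->
  unroll c i \in trans S /\ (unroll c i).2 = (unroll c i.+1).1.1.
Proof.
elim: i x c => [|i IH] x [//|r c] _ [_ rS rc].
  split=> //; rewrite /unroll /=.
  by case: c rc => [/= ->|r' c [->]] //; case: v_cycle.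
have uE j : unroll (r :: c) j.+1 = unroll (advance (r :: c)) j by rewrite /unroll iterSr.
rewrite !uE; case: c {uE} rc => [/= rc|r' c rc]; [exact: (IH y)|exact: (IH r.2)].
Qed.

(** Each turn of the cycle contributes at least one label. *)
Lemma unroll_labels n r c : exists m,
  n <= size (label_word (map (fun r : transition => r.1.2) (mkseq (unroll (r :: c)) m))).
Proof.
elim: n r c => [|n IH] r c; first by exists 0.
have [m nm] := IH r0 v; exists (size (r :: c) + (size (r0 :: v) + m)).
rewrite unroll_loop -cat_cons map_cat label_word_cat size_cat unroll_loop -cat_cons.
rewrite map_cat label_word_cat size_cat.
by case: label_word v_label nm => //= a w _; lia.
Qed.

End Lasso.

Lemma lasso x y u v :
  x \in init S -> reads u x y -> reads v y y -> v <> [::] ->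
  exists2 sigma, omega_language sigma & omega_prefix u sigma.
Proof.
move=> xi [s [<- xs]] [s' [<- ys]] v0.
have [c xc cs] := run_chain xs; have [[|r0 d] yd ds] := run_chain ys.
  by case: v0; rewrite -ds.
have v_label : label_word (map (fun r : transition => r.1.2) (r0 :: d)) <> [::].
  by rewrite ds.
(* The path to the cycle may be empty; one turn of the cycle is appended to make the initial list
   nonempty. *)
have [r [c' cE]] : exists r c', c ++ r0 :: d = r :: c'.
  by case: (c) => [|r c']; [exists r0, d|exists r, (c' ++ r0 :: d)].
have xc' : chain x (r :: c') y.
  by rewrite -cE; elim: (c) x xc {xi xs} => [|r' c1 IH] x /= => [->|[? ? /IH]].
pose f := unroll r0 d (r :: c').
have ftrans i : f i \in trans S /\ (f i).2 = (f i.+1).1.1.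
  exact: unroll_trans yd _ _ _ _ xc'.
have [sigma lab] : exists sigma, omega_label (fun i => (f i).1.2) sigma.
  apply: exists_omega_label => n; have [m nm] := unroll_labels v_label n r c'.
  by exists m; move: nm; rewrite /mkseq -map_comp.
exists sigma.
  exists (fun i => (f i).1.2), (fun i => (f i).1.1); split=> // [|i].
    by case: xc' => xr _ _; rewrite /f /unroll /= xr.
  by have [fi <-] := ftrans i; case: (f i) fi => [[]].
have := lab.1 (size (r :: c')).
have -> m : mkseq (fun i => (f i).1.2) m = map (fun r : transition => r.1.2) (mkseq f m).
  by rewrite /mkseq -map_comp.
(* The prefix obtained is [u] followed by the word of one turn, and is cut back to the length of
   [u]. *)
rewrite (unroll_prefix r0 d r c').2 -cE map_cat.
rewrite label_word_cat cs /omega_prefix => /(congr1 (take (size (label_word s)))).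
by rewrite take_size_cat // -map_take take_iota size_cat (minn_idPl _) ?leq_addr.
Qed.

(** * Labelled cycles by pigeonhole *)

Definition emits x y : Prop := exists2 w, reads w x y & w <> [::].

Fixpoint emit_path x (p : seq (state S)) : Prop :=
  if p is y :: p' then emits x y /\ emit_path y p' else True.

Lemma emits_trans x y z : emits x y -> emits y z -> emits x z.
Proof.
by move=> [[|a w] // aw _] [w' w'r _]; exists ((a :: w) ++ w') => //; apply: reads_cat aw w'r.
Qed.

Lemma emit_path_mem x p y : emit_path x p -> y \in p -> emits x y.
Proof.
elim: p x => //= z p IH x [xz zp]; rewrite inE => /predU1P[->//|yp].
exact: emits_trans xz (IH _ zp yp).
Qed.

Lemma reads_emit_path w x z : reads w x z ->
  exists2 p, emit_path x p & size p = size w.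
Proof.
elim: w x => [|a w IH] x; first by exists [::].
rewrite -cat1s => /reads_split[y xy /IH[p yp sp]].
by exists (y :: p); rewrite /= ?sp //; split=> //; exists [:: a].
Qed.

(** Either the head occurs again later, and [emits] is transitive along the path, or the repetition
    lies in the tail. *)
Lemma emit_cycle x p : emit_path x p -> ~~ uniq (x :: p) ->
  exists2 y, (exists w, reads w x y) & emits y y.
Proof.
elim: p x => //= z p IH x [xz zp]; rewrite negb_and negbK.
case/orP=> [xzp|/(IH _ zp)[y [w zy] yy]].
  by exists x; [exists [::], [::]|apply: (@emit_path_mem x (z :: p))].
by case: xz => w' xz _; exists y => //; exists (w' ++ w); exact: reads_cat xz zy.
Qed.

(* By pigeonhole, the states at which the letters of [w] are emitted repeat. *)
Lemma exists_omega_word x y z u w :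
  x \in init S -> reads u x y -> reads w y z -> #|state S| <= size w ->
  exists2 sigma, omega_language sigma & omega_prefix u sigma.
Proof.
move=> xi xy /reads_emit_path[p yp <-] le_p.
(* The list [y :: p] has one entry more than [w] has letters, hence more entries than there are
   states. *)
have [|y' [w' yy'] [v y'v v0]] := emit_cycle yp.
  apply/negP=> /card_uniqP up; have := max_card (mem (y :: p)).
  by rewrite up => /leq_trans/(_ le_p); rewrite ltnn.
have [sigma Lsigma pre] := lasso xi (reads_cat xy yy') y'v v0; exists sigma => //.
move: pre; rewrite /omega_prefix => /(congr1 (take (size u))).
by rewrite take_size_cat // -map_take take_iota size_cat (minn_idPl _) ?leq_addr.
Qed.

(** A finite part of the infinite run is taken, long enough to emit [size u + n] labels; its word
    then starts with [u]. *)
Lemma omega_language_reads sigma u n :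
  omega_language sigma -> omega_prefix u sigma ->
  exists w a b, [/\ a \in init S, n <= size w & reads (u ++ w) a b].
Proof.
case=> t [x [x0 xt [pre inf]]] uE.
have runs m : run (x 0) (mkseq t m) (x m).
  elim: m => // m IH; rewrite -addn1 mkseqD; apply/run_cat; exists (x m) => //=.
  by exists (x (m + 1)); rewrite addn0 addn1.
have [m le_m] := inf (size u + n).
exists (drop (size u) (label_word (mkseq t m))), (x 0), (x m); split=> //.
  by rewrite size_drop; lia.
exists (mkseq t m); split=> //; rewrite -[LHS](cat_take_drop (size u)); congr (_ ++ _).
rewrite [in LHS]pre -map_take take_iota (minn_idPl _) -?uE //; lia.
Qed.

(** A violation along an infinite word gives a witness by cutting the run after [#|state S|] further
    labels; conversely, the pigeonhole argument turns a witness into an infinite word with the same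
    prefix. *)
Lemma detectable_bad Xspec k1 k2 :
  bad Xspec k1 k2 = [::] <-> @omega_D_detectable S k1 k2 Xspec.
Proof.
split=> [bad0 sigma Lsigma w1 w2 pre kw1 kw2 [x [y [xE yE xyX]]]|det].
  have [w3 [a0 [a3 [a0i kw3]]]] := omega_language_reads #|state S| Lsigma pre.
  rewrite -catA => /reads_split[a1 a01 /reads_split[a2 a12 a23]].
  have /badP[q] : witness Xspec k1 k2; last by rewrite bad0.
  by exists w1, w2, w3, a0, a1, a2, a3, x, y.
case badE: (bad _ _ _) => [//|q l]; exfalso.
have /badP : exists q, q \in bad Xspec k1 k2 by exists q; rewrite badE mem_head.
move=> [w1 [w2 [w3 [a0 [a1 [a2 [a3 [x [y [[a0i a01 a12 a23] [kw1 kw2 kw3] [xE yE xyX]]]]]]]]]]].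
have [sigma Ls pre] := exists_omega_word a0i (reads_cat a01 a12) a23 kw3.
by apply: (det sigma Ls w1 w2 pre kw1 kw2); exists x, y.
Qed.

End Infinite.

(** * Size of the encoded input, and the theorem *)

Lemma tree_size_enc_elt (A : finType) (a : A) : tree_size (enc_elt a) <= 2 * #|A|.
Proof.
have lt_r : nat_of_ord (enum_rank a) < #|A| := ltn_ord _.
by rewrite tree_size_enc_nat; lia.
Qed.

Lemma tree_size_enc_enum (A : finType) (enc : A -> tree) (s : {pred A}) m N :
  (forall a, tree_size (enc a) <= N) -> #|s| <= m ->
  tree_size (enc_seq enc (enum s)) <= (m * N.+1).+1.
Proof.
move=> encN sm; apply: leq_trans (tree_size_enc_seq_le (N := N) _) _ => //.
by rewrite ltnS -cardE leq_mul2r sm orbT.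
Qed.

(** The programs are timed against the size of the encoding, whereas the theorem measures the
    automaton and the parameters; this converts one into the other. *)
Lemma tree_size_enc_input : exists2 B, poly_fun B &
  forall (S : fsa) (Xspec : {set state S * state S}) k1 k2,
    tree_size (enc_input Xspec k1 k2) <= B (fsa_size S + k1 + k2).
Proof.
(* [C] bounds one list entry, which holds at most three elements of size at most [2 * n], and [L] a
   list of [n] entries. The sum below counts five numbers, three lists and the specification of at
   most [n * n] pairs. *)
pose C n := 6 * n + 10; pose L n := n * (C n + 1) + 1.
exists (fun n => 5 * (2 * n + 1) + 3 * L n + (n * n * (C n + 1) + 1) + 20).
  by rewrite /L /C; poly_fun_tac.
move=> S Xspec k1 k2; set n := fsa_size S + k1 + k2.
have Xn : #|state S| <= n by rewrite /n /fsa_size; lia.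
have Tn : #|event S| <= n by rewrite /n /fsa_size; lia.
have Ln : #|label S| <= n by rewrite /n /fsa_size; lia.
have Rn : #|trans S| <= n by rewrite /n /fsa_size; lia.
have k1n : k1 <= n by rewrite /n; lia.
have k2n : k2 <= n by rewrite /n; lia.
have x_le (x : state S) := tree_size_enc_elt x.
have t_le (t : event S) := tree_size_enc_elt t.
have init_le : tree_size (enc_seq (@enc_elt _) (enum (init S))) <= L n.
  rewrite /L !addn1; apply: tree_size_enc_enum => [x|]; last first.
    exact: leq_trans (max_card _) Xn.
  by have := x_le x; rewrite /C; lia.
have trans_le : tree_size (enc_seq (@enc_trans S) (enum (trans S))) <= L n.
  rewrite /L !addn1; apply: tree_size_enc_enum => // -[[x t] y].
  rewrite /enc_trans [tree_size _]/=.
  by have := x_le x; have := x_le y; have := t_le t; rewrite /C; lia.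
have labels_le : tree_size (enc_seq (fun t => enc_opt (@enc_elt _) (labeling t))
    (enum (event S))) <= L n.
  rewrite /L !addn1; apply: tree_size_enc_enum => // t.
  case: (labeling t) => [a|]; rewrite [tree_size _]/= /C; last by lia.
  by have := tree_size_enc_elt a; lia.
have spec_le : tree_size (enc_spec Xspec) <= n * n * (C n + 1) + 1.
  rewrite !addn1; apply: tree_size_enc_enum => [[x y]|].
    by rewrite [tree_size _]/=; have := x_le x; have := x_le y; rewrite /C; lia.
  by apply: leq_trans (max_card _) _; rewrite card_prod leq_mul.
have sizeE a b : tree_size (Node a b) = (tree_size a + tree_size b).+1 by [].
by rewrite /enc_input /enc_fsa !sizeE !tree_size_enc_nat; lia.
Qed.

Theorem theorem4 :
  exists (c : com) (p : {poly nat}),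
    forall (S : fsa) (Xspec : {set state S * state S}) (k1 k2 : nat),
      decides_within c (enc_input Xspec k1 k2)
        (horner p (fsa_size S + k1 + k2)%N)
        (omega_D_detectable k1 k2 Xspec).
Proof.
(* The program answers yes when the encoded list of bad triples is a leaf, that is, when the list is
   empty. *)
have [c [n [T [TP decide]]]] := ptime_neg (ptime_is_node ptime_bad).
have [B BP le_B] := tree_size_enc_input.
have [p pE] := poly_fun_comp TP BP.
exists c, p => S Xspec k1 k2.
have [t [s [ct s0 _ tT _]]] :=
  decide (Instance Xspec k1 k2) (input_store (enc_input Xspec k1 k2)) erefl.
exists t, s; split=> //.
  by rewrite -pE; apply: leq_trans tT _; apply: poly_fun_mono (le_B _ _ _ _).
rewrite s0 -detectable_bad /=; by case: bad.
Qed.
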